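(* Let $\mathcal{I}\subset(0,1)$ be an infinite set having $0$ as an accumulation point. For each $\varepsilon\in\mathcal{I}$ let $\lambda^\varepsilon$ be an eigenvalue of $\mathcal{S}_\varepsilon$ and let $y_\varepsilon$ be a corresponding eigenfunction normalized in $L_2(a,b)$. If $\lambda^\varepsilon\to\lambda$ and $y_\varepsilon\to v$ weakly in $L_2(a,b)$ as $\mathcal{I}\ni\varepsilon\to0$, then $\lambda$ is an eigenvalue of $\mathcal{S}_{\alpha,\beta}(\Psi,\Phi)$ with corresponding eigenfunction $v$. Furthermore, $y_\varepsilon$ converges to $v$ in the norm of $L_2(a,b)$ as $\mathcal{I}\ni\varepsilon\to0$.
   Context: Let $a<0<b$ and let $U$ be a smooth real-valued function on $[a,b]$. $C_0^\infty(-1,1)$ denotes the real-valued $C^\infty$ functions on $\mathbb{R}$ supported in $[-1,1]$. Let $\Psi,\Phi,\Upsilon_1,\Upsilon_2\in C_0^\infty(-1,1)$ with $\operatorname{supp}\Psi=[-1,1]$, and let $\alpha,\beta,\gamma_1,\gamma_2\in\mathbb{R}$. For $\varepsilon\in(0,1)$ put $$\Psi_\varepsilon(x)=\alpha\varepsilon^{-4}\Psi(x/\varepsilon)+\beta\varepsilon^{-3}\Phi(x/\varepsilon)+\gamma_1\varepsilon^{-2}\Upsilon_1(x/\varepsilon)+\gamma_2\varepsilon^{-1}\Upsilon_2(x/\varepsilon).$$ $\mathcal{S}_\varepsilon$ is the operator in $L_2(a,b)$ given by $\mathcal{S}_\varepsilon f=f^{(4)}+Uf+\Psi_\varepsilon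 f$ with domain $\{f\in W_2^4(a,b): f(a)=f'(a)=0,\ f(b)=f'(b)=0\}$. Resonant set: $\Sigma_\Psi$ is the set of $\alpha\in\mathbb{R}$ for which the problem $w^{(4)}+\alpha\Psi w=0$ on $(-1,1)$, $w''(\pm1)=w'''(\pm1)=0$, has a nontrivial solution (an eigenfunction $w_\alpha$, with $\alpha$ as spectral parameter). Standing assumption (nondegenerate resonance): if $\alpha\in\Sigma_\Psi$, then $\alpha$ is a simple eigenvalue of this problem and $w_\alpha'(-1)\,w_\alpha'(1)\ne0$. In that case put $\theta_\Psi(\alpha)=w_\alpha'(1)/w_\alpha'(-1)$ and $\kappa=\int_{-1}^1\Phi(\xi)\bigl(w_\alpha(\xi)/w_\alpha'(-1)\bigr)^2d\xi$ (both independent of the choice of $w_\alpha$). Limit operator $\mathcal{S}_{\alpha,\beta}(\Psi,\Phi)$ in $L_2(a,b)$: it acts by $f\mapsto f^{(4)}+Uf$ on $(a,0)\cup(0,b)$. Its domain consists of those $f\in W_2^4((a,0)\cup(0,b))$ with $f(a)=f'(a)=f(b)=f'(b)=0$ and - if $\alpha\notin\Sigma_\Psi$: $f(\pm0)=f'(\pm0)=0$; - if $\alpha\in\Sigma_\Psi$: $f(\pm0)=0$, $f'(+0)-\theta_\Psi(\alpha)f'(-0)=0$, $\theta_\Psi(\alpha)f''(+0)-f''(-0)-\beta\kappa f'(-0)=0$. Here $f^{(k)}(\pm0)$ denote one-sided limits at $0$. *)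

(* Defs.v *)
From mathcomp Require Import all_boot all_order all_algebra.
From mathcomp Require Import all_classical all_reals all_analysis.
From mathcomp Require Import complex.

Set Implicit Arguments.
Unset Strict Implicit.
Unset Printing Implicit Defensive.

Import Order.TTheory GRing.Theory Num.Theory numFieldNormedType.Exports.

Local Open Scope classical_set_scope.
Local Open Scope ring_scope.
Local Open Scope complex_scope.

Definition smooth (R : realType) (f : R -> R) : Prop :=
  forall (n : nat) (x : R), derivable (derive1n n f) x 1.

(* C_0^oo(-1, 1): the support may be all of [-1, 1]. *)
Definition C0infty (R : realType) (f : R -> R) : Prop :=
  smooth f /\ closure [set x | f x != 0] `<=` `[-1, 1].

(* D is the sequence D 0, D 1 = (D 0)', D 2 = (D 0)'', ... of the derivatives,
   up to order n, of a function of class C^n on the closed interval [l, r];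
   continuity on [l, r] makes D k l and D k r the one-sided boundary values. *)
Definition derivatives_on (R : realType) (n : nat) (l r : R)
    (D : nat -> R -> R) : Prop :=
  (forall k, (k <= n)%N -> {within `[l, r], continuous (D k)}) /\
  (forall k, (k < n)%N ->
     forall x, x \in `]l, r[ -> is_derive x 1 (D k) (D k.+1 x)).

Definition smooth_on (R : realType) (l r : R) (f : R -> R) : Prop :=
  exists D : nat -> R -> R,
    (forall n, derivatives_on n l r D) /\ {in `[l, r], f =1 D 0%N}.

Definition ae_on (R : realType) (l r : R) (P : R -> Prop) : Prop :=
  {ae (@lebesgue_measure R), forall x, x \in `]l, r[ -> P x}.

(* The complex space L_2(l, r), its inner product (linear in the first
   variable), its norm, and weak convergence along a filter F. *)
Definition L2 (R : realType) (l r : R) (f : R -> R[i]) : Prop :=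
  [/\ measurable_fun `]l, r[ (fun x => complex.Re (f x)),
      measurable_fun `]l, r[ (fun x => complex.Im (f x)) &
      (\int[@lebesgue_measure R]_(x in `]l, r[)
         ((complex.Re (f x) ^+ 2 + complex.Im (f x) ^+ 2)%:E) < +oo)%E].

Definition L2inner (R : realType) (l r : R) (f g : R -> R[i]) : R[i] :=
  (\int[@lebesgue_measure R]_(x in `]l, r[) complex.Re (f x * (g x)^*)) +i*
  (\int[@lebesgue_measure R]_(x in `]l, r[) complex.Im (f x * (g x)^*)).

Definition L2norm (R : realType) (l r : R) (f : R -> R[i]) : R :=
  Num.sqrt (complex.Re (L2inner l r f f)).

Definition cvgC (R : realType) (F : set_system R) (u : R -> R[i]) (z : R[i])
    : Prop :=
  Normc.normc (u e - z) @[e --> F] --> (0 : R).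

Definition L2weak_cvg (R : realType) (l r : R) (F : set_system R)
    (y : R -> R -> R[i]) (v : R -> R[i]) : Prop :=
  forall g, L2 l r g ->
    cvgC F (fun e => L2inner l r (y e) g) (L2inner l r v g).

Definition L2strong_cvg (R : realType) (l r : R) (F : set_system R)
    (y : R -> R -> R[i]) (v : R -> R[i]) : Prop :=
  L2norm l r (fun x => y e x - v x) @[e --> F] --> (0 : R).

(* D 0 is the C^3 representative of an element of W_2^4(l, r), with D k its
   k-th derivative: D 3 is absolutely continuous, its derivative D 4 (defined
   up to a null set) being in L_2(l, r). *)
Definition W24 (R : realType) (l r : R) (D : nat -> R -> R[i]) : Prop :=
  [/\ derivatives_on 3 l r (fun k x => complex.Re (D k x)),
      derivatives_on 3 l r (fun k x => complex.Im (D k x)),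
      L2 l r (D 4%N) &
      forall x, x \in `[l, r] ->
        D 3%N x = D 3%N l +
          ((\int[@lebesgue_measure R]_(t in `[l, x]) complex.Re (D 4%N t)) +i*
           (\int[@lebesgue_measure R]_(t in `[l, x]) complex.Im (D 4%N t)))].

(* An unbounded operator in L_2 is given by its graph, a relation between
   functions that is invariant under equality almost everywhere: T f h means
   that f is in the domain of T and that T f = h. *)
Definition eigenpair (R : realType) (l r : R)
    (T : (R -> R[i]) -> (R -> R[i]) -> Prop) (lam : R[i]) (f : R -> R[i])
    : Prop :=
  [/\ L2 l r f, ~ ae_on l r (fun x => f x = 0) & T f (fun x => lam * f x)].

Definition Psi_eps (R : realType) (Psi Phi Ups1 Ups2 : R -> R)
    (alpha beta gamma1 gamma2 eps : R) (x : R) : R :=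
  alpha * eps ^- 4 * Psi (x / eps) + beta * eps ^- 3 * Phi (x / eps)
  + gamma1 * eps ^- 2 * Ups1 (x / eps) + gamma2 * eps^-1 * Ups2 (x / eps).

Definition S_eps (R : realType) (a b : R) (U Psi Phi Ups1 Ups2 : R -> R)
    (alpha beta gamma1 gamma2 eps : R) (f h : R -> R[i]) : Prop :=
  exists D : nat -> R -> R[i],
    [/\ W24 a b D,
        ae_on a b (fun x => f x = D 0%N x),
        D 0%N a = 0 /\ D 1%N a = 0,
        D 0%N b = 0 /\ D 1%N b = 0 &
        ae_on a b (fun x => h x = D 4%N x + (U x)%:C * f x +
          (Psi_eps Psi Phi Ups1 Ups2 alpha beta gamma1 gamma2 eps x)%:C * f x)].

(* W 0 solves w'''' + alpha Psi w = 0 on (-1, 1), w'' = w''' = 0 at -1 and 1,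
   and W k is its k-th derivative. *)
Definition resonance_solution (R : realType) (Psi : R -> R) (alpha : R)
    (W : nat -> R -> R) : Prop :=
  [/\ derivatives_on 4 (-1) 1 W,
      forall x, x \in `]-1, 1[ -> W 4%N x + alpha * Psi x * W 0%N x = 0,
      W 2%N (-1) = 0 /\ W 2%N 1 = 0 &
      W 3%N (-1) = 0 /\ W 3%N 1 = 0].

Definition resonance_eigenfunction (R : realType) (Psi : R -> R) (alpha : R)
    (W : nat -> R -> R) : Prop :=
  resonance_solution Psi alpha W /\ exists2 x, x \in `[-1, 1] & W 0%N x != 0.

Definition Sigma (R : realType) (Psi : R -> R) : set R :=
  [set alpha | exists W, resonance_eigenfunction Psi alpha W].

Definition simple_eigenvalue (R : realType) (Psi : R -> R) (alpha : R) : Prop :=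
  Sigma Psi alpha /\
  forall W1 W2, resonance_eigenfunction Psi alpha W1 ->
    resonance_solution Psi alpha W2 ->
    exists c : R, forall x, x \in `[-1, 1] -> W2 0%N x = c * W1 0%N x.

Definition nondegenerate_resonance (R : realType) (Psi : R -> R) (alpha : R)
    : Prop :=
  Sigma Psi alpha ->
  simple_eigenvalue Psi alpha /\
  forall W, resonance_eigenfunction Psi alpha W ->
    W 1%N (-1) * W 1%N 1 != 0.

(* A choice of w_alpha together with its derivatives. *)
Definition w_ (R : realType) (Psi : R -> R) (alpha : R) : nat -> R -> R :=
  get [set W | resonance_eigenfunction Psi alpha W].

Definition theta (R : realType) (Psi : R -> R) (alpha : R) : R :=
  w_ Psi alpha 1 1 / w_ Psi alpha 1 (-1).

Definition kappa (R : realType) (Psi Phi : R -> R) (alpha : R) : R :=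
  \int[@lebesgue_measure R]_(xi in `[-1, 1])
    (Phi xi * (w_ Psi alpha 0 xi / w_ Psi alpha 1 (-1)) ^+ 2).

(* Dm and Dp are the derivatives of f on (a, 0) and (0, b), so that
   Dm k 0 and Dp k 0 are the one-sided limits of the k-th derivative. *)
Definition interface_conditions (R : realType) (Psi Phi : R -> R)
    (alpha beta : R) (Dm Dp : nat -> R -> R[i]) : Prop :=
  (~ Sigma Psi alpha ->
     [/\ Dm 0%N 0 = 0, Dp 0%N 0 = 0, Dm 1%N 0 = 0 & Dp 1%N 0 = 0]) /\
  (Sigma Psi alpha ->
     [/\ Dm 0%N 0 = 0, Dp 0%N 0 = 0,
         Dp 1%N 0 - (theta Psi alpha)%:C * Dm 1%N 0 = 0 &
         (theta Psi alpha)%:C * Dp 2%N 0 - Dm 2%N 0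
           - (beta * kappa Psi Phi alpha)%:C * Dm 1%N 0 = 0]).

Definition S_lim (R : realType) (a b : R) (U Psi Phi : R -> R)
    (alpha beta : R) (f h : R -> R[i]) : Prop :=
  exists Dm Dp : nat -> R -> R[i],
    [/\ [/\ W24 a 0 Dm, ae_on a 0 (fun x => f x = Dm 0%N x),
            W24 0 b Dp & ae_on 0 b (fun x => f x = Dp 0%N x)],
        [/\ Dm 0%N a = 0, Dm 1%N a = 0, Dp 0%N b = 0 & Dp 1%N b = 0],
        interface_conditions Psi Phi alpha beta Dm Dp,
        ae_on a 0 (fun x => h x = Dm 4%N x + (U x)%:C * f x) &
        ae_on 0 b (fun x => h x = Dp 4%N x + (U x)%:C * f x)].

(* Main.v *)
(** The problem is elementary once convergence is taken along an ultrafilter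
finer than the given filter, since then every bounded scalar quantity converges
and no subsequences are needed. Eigenvalues are real, so the real and imaginary
parts of an eigenfunction y can be treated separately. On both sides of the
support of the potential, y solves a regular equation and its Cauchy data at a
and b are controlled by its L_2 norm, so y and its derivatives converge there,
up to the points -eps and eps. Inside, z(xi) = y(eps xi) / eps solves a small
perturbation of w'''' + alpha Psi w = 0 with z''(+-1), z'''(+-1) -> 0 and
z'(+-1) = y'(+-eps) bounded. A blow-up of z would produce a nonzero resonant
solution with vanishing derivative at -1, which nondegeneracy forbids; hence z
converges to a resonant solution W, which gives v(+-0) = 0 and
v'(+-0) = W'(+-1). The last interface condition is the limit of Lagrange's
identity between z and w_alpha, divided by eps. Altogether y converges uniformly
on (a, b), hence strongly, and the uniform limit must be the weak limit v. *)

Require Import Defs.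
From mathcomp Require Import all_boot all_order all_algebra.
From mathcomp Require Import all_classical all_reals all_analysis.
From mathcomp Require Import complex measurable_realfun ring lra.
Import Order.TTheory GRing.Theory Num.Theory numFieldNormedType.Exports.
Set Implicit Arguments.
Unset Strict Implicit.
Unset Printing Implicit Defensive.
Local Open Scope classical_set_scope.
Local Open Scope ring_scope.

(** * Calculus on compact intervals *)

Section calculus.
Context {R : realType}.
Implicit Types (f g : R -> R) (l r x y : R) (D : nat -> R -> R).
Local Notation mu := (@lebesgue_measure R).

(** On the whole of [a, b] the coefficient of the equation has size eps^-4, so no Gronwall estimate
    crosses the support of the potential uniformly in eps; on each of the two scales, however, the
    coefficient converges uniformly. Compactness then needs only Gronwall: bounded Cauchy data at
    one point converge along the ultrafilter, and for a linear equation this convergence spreads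
    uniformly over the interval. So everything reduces to bounding the data, by one scheme on both
    scales: unbounded data, normalized to size 1, leave a nonzero limit solution, excluded outside
    by the L_2 norm and inside by the boundary values. The factor 1/eps in z is dictated by z' = y',
    the quantity transmitted through 0. Then z'' = eps y'' and z''' = eps^2 y''', so the free
    boundary conditions hold in the limit. Since w_alpha'' and w_alpha''' vanish at -1 and 1,
    Lagrange's identity divided by eps keeps in the limit only y'' at -eps and eps and the integral
    with Phi; the Upsilon terms are of higher order in eps. *)

Lemma within_itv_contP l r f :
  {within `[l, r], continuous f} <->
  forall x, x \in `[l, r] -> forall d, 0 < d -> exists2 e, 0 < e &
    forall y, y \in `[l, r] -> `|y - x| < e -> `|f y - f x| < d.
Proof.
split=> [/subspace_continuousP cf x xlr d d0|H].
  have /cvgrPdist_lt /(_ _ d0) := cf x xlr.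
  rewrite /prop_near1 /= nbhs_nearE near_withinE => /nbhs_ballP[e /= e0 He].
  exists e => // y ylr yx; rewrite distrC; apply: He => //.
  by rewrite /ball /= distrC.
apply/subspace_continuousP => x xlr; apply/cvgrPdist_lt => d d0.
have [e e0 He] := H x xlr d d0.
rewrite /prop_near1 /= nbhs_nearE near_withinE; apply/nbhs_ballP.
exists e => // y /= xy ylr; rewrite distrC; apply: He => //.
by rewrite distrC.
Qed.

Lemma is_derive_eqr f x (df df' : R) :
  is_derive x 1 f df -> df = df' -> is_derive x 1 f df'.
Proof. by move=> H <-. Qed.

Lemma is_derive_mul f g x (df dg : R) : is_derive x 1 f df -> is_derive x 1 g dg ->
  is_derive x 1 (fun t => f t * g t) (df * g x + f x * dg).
Proof.
move=> hf hg; have -> : df * g x + f x * dg = f x *: dg + g x *: df.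
  by rewrite /GRing.scale /=; ring.
exact: is_deriveM.
Qed.

Lemma is_derive_add f g x (df dg : R) : is_derive x 1 f df -> is_derive x 1 g dg ->
  is_derive x 1 (fun t => f t + g t) (df + dg).
Proof. by move=> hf hg; exact: is_deriveD. Qed.

Lemma is_derive_sub f g x (df dg : R) : is_derive x 1 f df -> is_derive x 1 g dg ->
  is_derive x 1 (fun t => f t - g t) (df - dg).
Proof. by move=> hf hg; exact: is_deriveB. Qed.

Lemma is_derive_scale f x (c df : R) : is_derive x 1 f df ->
  is_derive x 1 (fun t => c * f t) (c * df).
Proof. by move=> hf; exact: is_deriveZ. Qed.

Lemma within_cst l r (c : R) : {within `[l, r], continuous (fun=> c)}.
Proof. by move=> x; exact: cvg_cst. Qed.

Lemma within_add l r f g : {within `[l, r], continuous f} ->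
  {within `[l, r], continuous g} ->
  {within `[l, r], continuous (fun x => f x + g x)}.
Proof. by move=> cf cg x; apply: cvgD; [exact: cf|exact: cg]. Qed.

Lemma within_sub l r f g : {within `[l, r], continuous f} ->
  {within `[l, r], continuous g} ->
  {within `[l, r], continuous (fun x => f x - g x)}.
Proof. by move=> cf cg x; apply: cvgB; [exact: cf|exact: cg]. Qed.

Lemma within_mul l r f g : {within `[l, r], continuous f} ->
  {within `[l, r], continuous g} ->
  {within `[l, r], continuous (fun x => f x * g x)}.
Proof. by move=> cf cg x; apply: cvgM; [exact: cf|exact: cg]. Qed.

Lemma within_sub_itv l r l' r' f : l <= l' -> r' <= r ->
  {within `[l, r], continuous f} -> {within `[l', r'], continuous f}.
Proof.
by move=> ll rr; apply: continuous_subspaceW; apply: subset_itv; rewrite bnd_simp.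
Qed.

Lemma within_bounded l r f : {within `[l, r], continuous f} ->
  exists2 M, 0 <= M & forall x, x \in `[l, r] -> `|f x| <= M.
Proof.
move=> cf; have [lr|rl] := leP l r; last first.
  exists 0 => // x; rewrite in_itv /= => /andP[lx xr].
  by have := le_trans lx xr; rewrite leNgt rl.
have [c1 c1l H1] := EVT_max lr cf; have [c2 c2l H2] := EVT_min lr cf.
exists (`|f c1| + `|f c2|) => [|x xlr]; first by rewrite addr_ge0.
have := H1 x xlr; have := H2 x xlr.
have := ler_norm (f c1); have := ler_norm (- f c2); rewrite normrN.
have := normr_ge0 (f c1); have := normr_ge0 (f c2).
rewrite ler_norml; lra.
Qed.

Lemma mvt_lipschitz l r f df C :
  {within `[l, r], continuous f} ->
  (forall x, x \in `]l, r[ -> is_derive x 1 f (df x)) ->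
  (forall x, x \in `]l, r[ -> `|df x| <= C) ->
  forall x y, x \in `[l, r] -> y \in `[l, r] -> `|f x - f y| <= C * `|x - y|.
Proof.
move=> cf fd dC x y; wlog xy : x y / y <= x.
  move=> W xl yl; have [yx|xy] := leP y x; first exact: W.
  by rewrite distrC (distrC x); apply: W => //; exact: ltW.
rewrite !in_itv /= => /andP[lx xr] /andP[ly yr].
move: xy; rewrite le_eqVlt => /predU1P[->|yx].
  by rewrite !subrr !normr0 mulr0.
have sub z : z \in `]y, x[ -> z \in `]l, r[.
  rewrite !in_itv /= => /andP[yz zx].
  by rewrite (le_lt_trans ly yz) (lt_le_trans zx xr).
have [c cyx ->] := @MVT _ f df y x yx (fun z zx => fd z (sub z zx))
  (within_sub_itv ly xr cf).
by rewrite normrM ler_wpM2r// dC// sub.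
Qed.

Lemma continuous_integrable l r f : {within `[l, r], continuous f} ->
  mu.-integrable `[l, r] (EFin \o f).
Proof.
by move=> cf; apply: continuous_compact_integrable => //; exact: segment_compact.
Qed.

Lemma primitive_within l r f : l < r -> {within `[l, r], continuous f} ->
  {within `[l, r], continuous (fun x => \int[mu]_(t in `[l, x]) f t)} /\
  forall x, x \in `]l, r[ ->
    is_derive x 1 (fun x => \int[mu]_(t in `[l, x]) f t) (f x).
Proof.
move=> lr cf; split.
  exact: (parameterized_integral_continuous (ltW lr) (continuous_integrable cf)).
move=> x xlr.
have cfx := within_continuous_continuous lr cf xlr.
move: xlr; rewrite in_itv /= => /andP[lx xr].
have [d e] := continuous_FTC1_closed xr (continuous_integrable cf) lx cfx.
split; first exact: d.
by rewrite -derive1E; exact: e.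
Qed.

Lemma Rintegral_derivative l r f F : l < r -> {within `[l, r], continuous f} ->
  {within `[l, r], continuous F} ->
  (forall x, x \in `]l, r[ -> is_derive x 1 F (f x)) ->
  forall x, x \in `[l, r] -> F x = F l + \int[mu]_(t in `[l, x]) f t.
Proof.
move=> lr cf cF dF x xlr; have [cP dP] := primitive_within lr cf.
have ll : l \in `[l, r] by rewrite in_itv /= lexx ltW.
(* The difference of F and the primitive of f has derivative 0, hence Lipschitz constant 0. *)
have := @mvt_lipschitz l r (fun x => F x - \int[mu]_(t in `[l, x]) f t)
  (fun=> 0) 0 (within_sub cF cP) _ _ x l xlr ll.
rewrite mul0r set_itv1 Rintegral_set1 subr0 => H.
suff : `|F x - \int[mu]_(t in `[l, x]) f t - F l| <= 0.
  by rewrite normr_le0 => /eqP; lra.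
apply: H => [y ylr|y ylr]; last by rewrite normr0.
have := is_deriveB (dF y ylr) (dP y ylr).
by rewrite subrr.
Qed.

Lemma derivatives_sub_itv n l r l' r' D : l <= l' -> r' <= r ->
  derivatives_on n l r D -> derivatives_on n l' r' D.
Proof.
move=> ll rr [cD dD]; split=> k kn; first exact: (within_sub_itv ll rr (cD k kn)).
move=> x xl; apply: dD => //; move: xl; rewrite !in_itv /= => /andP[a1 a2].
by rewrite (le_lt_trans ll a1) (lt_le_trans a2 rr).
Qed.

Lemma derivatives_le n m l r D : (m <= n)%N ->
  derivatives_on n l r D -> derivatives_on m l r D.
Proof.
move=> mn [cD dD]; split=> k km; first exact: cD (leq_trans km mn).
exact: dD (leq_trans km mn).
Qed.

Lemma derivatives_lin n l r D1 D2 (c1 c2 : R) :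
  derivatives_on n l r D1 -> derivatives_on n l r D2 ->
  derivatives_on n l r (fun k x => c1 * D1 k x + c2 * D2 k x).
Proof.
move=> [cD1 dD1] [cD2 dD2]; split=> k kn.
  apply: within_add; apply: within_mul; try exact: within_cst.
    exact: cD1.
  exact: cD2.
move=> x xl; exact: (is_derive_add (is_derive_scale c1 (dD1 k kn x xl))
  (is_derive_scale c2 (dD2 k kn x xl))).
Qed.

(** In the open interval [D k.+1] is the derivative of a locally zero function. At an endpoint it is
    no derivative, only a continuous extension, so its value is read off from interior points
    nearby; the endpoint values are the ones needed later. *)
Lemma derivatives_zero n l r D : l < r -> derivatives_on n l r D ->
  (forall x, x \in `[l, r] -> D 0%N x = 0) ->
  forall k, (k <= n)%N -> forall x, x \in `[l, r] -> D k x = 0.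
Proof.
move=> lr [cD dD] D0; elim=> [//|k IH] kn x xlr.
have oo y : y \in `]l, r[ -> D k.+1 y = 0.
  move=> ylr; have H := dD k kn y ylr.
  have /near_eq_is_derive H2 : \forall z \near y, D k z = cst 0 z.
    near=> z; apply: IH => //; first exact: ltnW.
    by apply: subset_itv_oo_cc; near: z; exact: near_in_itvoo.
  by rewrite -(@derive_val _ _ _ _ _ _ _ (H2 _ _ H)) derive_cst.
have /within_itv_contP /(_ x xlr) cx := cD k.+1 kn.
apply/eqP; rewrite -normr_eq0; apply/negP => /negP nz.
have pz : 0 < `|D k.+1 x| by rewrite lt_def nz normr_ge0.
have [e e0 He] := cx _ pz.
have [y yoo yx] : exists2 y, y \in `]l, r[ & `|y - x| < e.
  move: xlr; rewrite in_itv /= => /andP[lx xr].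
  (* Moving x by the fraction t towards the midpoint enters the open interval, and the displacement
     is at most t (r - l) / 2, less than e. *)
  pose t := Num.min (1/2) (e / (2 * (r - l))).
  have rl : 0 < r - l by lra.
  have t0 : 0 < t by rewrite lt_min; apply/andP; split; [lra|apply: divr_gt0; lra].
  have t1 : t <= 1/2 by rewrite ge_min lexx.
  have t2 : t * (r - l) <= e / 2.
    have : t <= e / (2 * (r - l)) by rewrite ge_min lexx orbT.
    rewrite ler_pdivlMr; lra.
  exists (x + t * ((l + r) / 2 - x)).
    rewrite in_itv /=; apply/andP; split; nra.
  have -> : x + t * ((l + r) / 2 - x) - x = t * ((l + r) / 2 - x) by ring.
  rewrite ltr_norml; apply/andP; split; nra.
have := He y (subset_itv_oo_cc yoo) yx.
by rewrite oo// sub0r normrN ltxx.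
Unshelve. all: by end_near. Qed.

(** The chain rule produces rho^k. The amplitude c is free because the inner rescaling takes c =
    1/eps and the outer one c = 1. *)
Lemma derivatives_affine n l r l' r' D (c p rho : R) : 0 < rho ->
  l <= p + rho * l' -> p + rho * r' <= r ->
  derivatives_on n l r D ->
  derivatives_on n l' r' (fun k x => c * rho ^+ k * D k (p + rho * x)).
Proof.
move=> rho0 ll rr [cD dD].
split=> k kn.
  apply: within_mul; first exact: within_cst.
  apply/within_itv_contP => x xl d d0.
  have sub z : z \in `[l', r'] -> p + rho * z \in `[l, r].
    by rewrite !in_itv /= => /andP[a1 a2]; apply/andP; split; nra.
  have /within_itv_contP /(_ _ (sub x xl) d d0) [e e0 He] := cD k kn.
  exists (e / rho) => [|y yl yx]; first exact: divr_gt0.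
  apply: He; first exact: sub.
  have -> : p + rho * y - (p + rho * x) = rho * (y - x) by ring.
  by rewrite normrM gtr0_norm// mulrC -ltr_pdivlMr.
move=> x xl.
have xl' : p + rho * x \in `]l, r[.
  by move: xl; rewrite !in_itv /= => /andP[a1 a2]; apply/andP; split; nra.
have H := dD k kn _ xl'.
have Ha : is_derive x 1 (fun x : R => p + rho * x) rho.
  have := is_deriveD (is_derive_cst p x 1) (is_deriveZ rho (is_derive_id x (1 : R))).
  by rewrite add0r /GRing.scale /= mulr1.
have := is_deriveZ (c * rho ^+ k)
  (@is_derive1_comp _ (D k) (fun x : R => p + rho * x) x _ _ H Ha).
by rewrite /GRing.scale /= exprSr; congr is_derive; ring.
Qed.

End calculus.

(** * Gronwall estimates for fourth-order equations *)

Section gronwall.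
Context {R : realType}.
Implicit Types (f g : R -> R) (l r x y : R) (D : nat -> R -> R).

(** The derivative of F(t) exp(- c t) is (F' - c F) exp(- c t), which is nonpositive. *)
Lemma exp_scale_decr l r (F dF : R -> R) (c : R) :
  {within `[l, r], continuous F} ->
  (forall x, x \in `]l, r[ -> is_derive x 1 F (dF x)) ->
  (forall x, x \in `]l, r[ -> dF x <= c * F x) ->
  forall x y, x \in `[l, r] -> y \in `[l, r] -> x <= y ->
  F y * expR (- c * y) <= F x * expR (- c * x).
Proof.
move=> cF dF_ le x y; rewrite !in_itv /= => /andP[lx xr] /andP[ly yr].
rewrite le_eqVlt => /predU1P[->//|xy].
have sub z : z \in `]x, y[ -> z \in `]l, r[.
  rewrite !in_itv /= => /andP[xz zy].
  by rewrite (le_lt_trans lx xz) (lt_le_trans zy yr).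
have dE (z : R) : is_derive z 1 (fun t : R => expR (- c * t)) (- c * expR (- c * z)).
  have Ha : is_derive z 1 (fun x : R => - c * x) (- c).
    by have := is_deriveZ (- c) (is_derive_id z (1 : R)); rewrite /GRing.scale /= mulr1.
  have := @is_derive1_comp _ expR (fun x : R => - c * x) z _ _ (is_derive_expR _) Ha.
  by rewrite /= mulrC.
pose f := fun t : R => F t * expR (- c * t).
pose df := fun t : R => (dF t - c * F t) * expR (- c * t).
suff [z zxy H] : exists2 z, z \in `]x, y[ & f y - f x = df z * (y - x).
  rewrite -subr_le0 -/(f y) -/(f x) H; apply: mulr_le0_ge0; last by rewrite subr_ge0 ltW.
  apply: mulr_le0_ge0; last exact: expR_ge0.
  by rewrite subr_le0; apply: le; exact: sub.
have fd z : z \in `]x, y[ -> is_derive z 1 f (df z).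
  move=> zxy; apply: (is_derive_eqr (is_derive_mul (dF_ z (sub z zxy)) (dE z))).
  by rewrite /df; ring.
have fc : {within `[x, y], continuous f}.
  apply: within_mul; first exact: within_sub_itv cF.
  by apply: derivable_within_continuous => z _; case: (dE z).
exact: (@MVT R f df x y xy fd fc).
Qed.

(** As |F'| is bounded, not just F', both F exp(- K t) decreases and F exp(K t) increases, so the
    estimate runs in either direction from y. The increasing case is the decreasing one for - F with
    constant - K. *)
Lemma gronwall_scalar l r (F dF : R -> R) (K : R) : 0 <= K ->
  {within `[l, r], continuous F} ->
  (forall x, x \in `]l, r[ -> is_derive x 1 F (dF x)) ->
  (forall x, x \in `]l, r[ -> `|dF x| <= K * F x) ->
  (forall x, 0 <= F x) ->
  forall x y, x \in `[l, r] -> y \in `[l, r] ->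
  F x <= expR (K * (r - l)) * F y.
Proof.
move=> K0 cF dF_ le F0 x y xlr ylr.
have main (u v : R) : F x * expR u <= F y * expR v -> v - u <= K * (r - l) ->
    F x <= expR (K * (r - l)) * F y.
  move=> H uv; apply: (@le_trans _ _ (expR (v - u) * F y)).
    by rewrite expRD expRN mulrAC ler_pdivlMr ?expR_gt0// [leRHS]mulrC.
  by apply: ler_wpM2r; rewrite ?ler_expR.
have [lx ly] := (xlr, ylr); rewrite !in_itv /= in lx ly.
have [xy|/ltW yx] := leP x y.
  apply: (main (K * x) (K * y)); last by nra.
  have := @exp_scale_decr l r (fun x => - F x) (fun x => - dF x) (- K)
   _ _ _ x y xlr ylr xy.
  rewrite opprK !mulNr lerN2; apply => [z|z zl|z zl].
  - exact: cvgN (cF z).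
  - exact: is_deriveN (dF_ z zl).
  - by have := le z zl; rewrite ler_norml => /andP[+ _]; lra.
apply: (main (- K * x) (- K * y)); last by nra.
have := @exp_scale_decr l r F dF K cF dF_ _ y x ylr xlr yx; apply.
by move=> z zl; apply: le_trans (le z zl); exact: ler_norm.
Qed.

(** Squared size of the Cauchy data at x, written with products so that the product rule applies as
    it stands. *)
Definition energy D x :=
  D 0%N x * D 0%N x + D 1%N x * D 1%N x + D 2%N x * D 2%N x + D 3%N x * D 3%N x.

Lemma energyE D x :
  energy D x = D 0%N x ^+ 2 + D 1%N x ^+ 2 + D 2%N x ^+ 2 + D 3%N x ^+ 2.
Proof. by rewrite /energy -!expr2. Qed.

Lemma energy_ge0 D x : 0 <= energy D x.
Proof. by rewrite energyE !addr_ge0// sqr_ge0. Qed.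

Lemma le_energy D x k : (k < 4)%N -> `|D k x| <= Num.sqrt (energy D x).
Proof.
move=> k4; rewrite -sqrtr_sqr ler_wsqrtr// energyE.
have := (sqr_ge0 (D 0%N x), sqr_ge0 (D 1%N x), sqr_ge0 (D 2%N x), sqr_ge0 (D 3%N x)).
by case: k k4 => [|[|[|[|]]]]// _ [[[]]]; lra.
Qed.

Lemma energy_le D x B : (forall k, (k < 4)%N -> `|D k x| <= B) ->
  energy D x <= 4 * B ^+ 2.
Proof.
move=> H; have B0 : 0 <= B by apply: le_trans (H 0%N isT).
have S k : (k < 4)%N -> D k x ^+ 2 <= B ^+ 2.
  by move=> k4; rewrite -[D k x ^+ 2]real_normK ?num_real// lerXn2r ?nnegrE ?H.
have := (S 0%N isT, S 1%N isT, S 2%N isT, S 3%N isT).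
by rewrite energyE => -[[[]]]; lra.
Qed.

(** The energy has derivative 2 (D0 D1 + D1 D2 + D2 D3 + D3 D4). The inequality 2uv <= u^2 + v^2,
    together with D4^2 <= 2 M^2 D0^2 + 2 d^2, bounds it by 3 + 2 M^2 times energy + d^2. Adding the
    constant d^2 absorbs the inhomogeneous term. *)
Lemma gronwall l r D (M d : R) : derivatives_on 4 l r D -> 0 <= M -> 0 <= d ->
  (forall x, x \in `[l, r] -> `|D 4%N x| <= M * `|D 0%N x| + d) ->
  forall x y, x \in `[l, r] -> y \in `[l, r] ->
  energy D x + d ^+ 2 <=
    expR ((3 + 2 * M ^+ 2) * (r - l)) * (energy D y + d ^+ 2).
Proof.
move=> [cD dD] M0 d0 H x y xlr ylr.
apply: (@gronwall_scalar l r (fun x => energy D x + d ^+ 2)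
  (fun x => 2 * (D 0%N x * D 1%N x + D 1%N x * D 2%N x + D 2%N x * D 3%N x +
    D 3%N x * D 4%N x)));
  [| | | | |exact: xlr|exact: ylr].
- by rewrite addr_ge0// mulr_ge0// sqr_ge0.
- have sq k (k4 : (k < 4)%N) := within_mul (cD k (ltnW k4)) (cD k (ltnW k4)).
  apply: within_add (@within_cst _ _ _ (d ^+ 2)).
  exact: (within_add (within_add (within_add (sq 0%N isT) (sq 1%N isT)) (sq 2%N isT))
    (sq 3%N isT)).
- move=> z zl.
  have d_ k (k4 : (k < 4)%N) := is_derive_mul (dD k k4 z zl) (dD k k4 z zl).
  apply: (is_derive_eqr (is_derive_add (is_derive_add (is_derive_add (is_derive_add
    (d_ 0%N isT) (d_ 1%N isT)) (d_ 2%N isT)) (d_ 3%N isT)) (is_derive_cst (d ^+ 2) z 1))).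
  by rewrite /GRing.scale /=; ring.
- move=> z zl; have := H z (subset_itv_oo_cc zl).
  have sq : D 0%N z ^+ 2 = `|D 0%N z| ^+ 2 by rewrite real_normK ?num_real.
  rewrite energyE sq; move: (`|D 0%N z|) sq (normr_ge0 (D 0%N z)) => n0 sq n0p.
  move: (D 0%N z) (D 1%N z) (D 2%N z) (D 3%N z) (D 4%N z) sq => z0 z1 z2 z3 z4 sq h4.
  have S4 : z4 ^+ 2 <= 2 * M ^+ 2 * n0 ^+ 2 + 2 * d ^+ 2.
    have : `|z4| ^+ 2 <= (M * n0 + d) ^+ 2.
      by rewrite lerXn2r ?nnegrE// (le_trans _ h4).
    rewrite real_normK ?num_real//.
    have := sqr_ge0 (M * n0 - d); nra.
  have := sqr_ge0 M.
  rewrite -sq in S4 *.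
  have p1 := sqr_ge0 (z0 - z1); have p2 := sqr_ge0 (z1 - z2).
  have p3 := sqr_ge0 (z2 - z3); have p4 := sqr_ge0 (z3 - z4).
  have q1 := sqr_ge0 (z0 + z1); have q2 := sqr_ge0 (z1 + z2).
  have q3 := sqr_ge0 (z2 + z3); have q4 := sqr_ge0 (z3 + z4).
  have r1 := mulr_ge0 (sqr_ge0 M) (sqr_ge0 z1).
  have r2 := mulr_ge0 (sqr_ge0 M) (sqr_ge0 z2).
  have r3 := mulr_ge0 (sqr_ge0 M) (sqr_ge0 z3).
  have r4 := mulr_ge0 (sqr_ge0 M) (sqr_ge0 d).
  have [s0 s1 s2 s3 s4] : [/\ 0 <= z0 ^+ 2, 0 <= z1 ^+ 2, 0 <= z2 ^+ 2, 0 <= z3 ^+ 2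
    & 0 <= d ^+ 2] by rewrite !sqr_ge0.
  by move=> _; rewrite ler_norml; apply/andP; split; lra.
- by move=> z; rewrite addr_ge0 ?sqr_ge0 ?energy_ge0.
Qed.

End gronwall.

(** * Uniform convergence along ultrafilters *)

Section ultra.
Context {R : realType} {T : Type}.
Implicit Types (F : set_system T).

(** Compactness of [-B, B] gives a cluster point, and an ultrafilter converges to each of its
    cluster points. *)
Lemma ultra_bounded_cvg F (u : T -> R) (B : R) {FU : UltraFilter F} :
  (\forall e \near F, `|u e| <= B) -> exists c : R, u e @[e --> F] --> c.
Proof.
move=> uB.
have [p [_ clp]] : [set` `[- B, B]] `&` cluster (u e @[e --> F]) !=set0.
  apply: (@segment_compact R (- B) B); apply: filterS uB => e.
  by rewrite /= in_itv /= ler_norml.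
exists p => V nV; have [//|H] := in_ultra_setVsetC (u @^-1` V) FU.
by have [z [/= nz vz]] := clp (~` V) V H nV.
Qed.

(** An ultrafilter contains a set or its complement, so a function that is not eventually bounded
    above already tends to infinity, without passing to a subsequence. *)
Lemma ultra_unbounded F (u : T -> R) {FU : UltraFilter F} :
  (exists B, \forall e \near F, u e <= B) \/ forall B, \forall e \near F, B < u e.
Proof.
have [|H] := pselect (exists B, \forall e \near F, u e <= B); first by left.
right=> B; have [|H2] := in_ultra_setVsetC [set e | B < u e] FU; first exact.
exfalso; apply: H; exists B; apply: filterS H2 => e /= /negP.
by rewrite -leNgt.
Qed.

Definition unif_cvg F l r (f_ : T -> R -> R) (f : R -> R) :=
  forall d, 0 < d ->
    \forall e \near F, forall x, x \in `[l, r] -> `|f_ e x - f x| < d.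

Lemma unif_cvg_at F l r f_ f x {FF : Filter F} : unif_cvg F l r f_ f ->
  x \in `[l, r] -> f_ e x @[e --> F] --> f x.
Proof.
move=> H xl; apply/cvgrPdist_lt => d d0; near=> e.
by rewrite distrC; move: x xl; near: e; exact: H.
Unshelve. all: by end_near. Qed.

Lemma unif_cvg_cst F l r f {FF : Filter F} : unif_cvg F l r (fun=> f) f.
Proof. by move=> d d0; apply: nearW => e x _; rewrite subrr normr0. Qed.

Lemma unif_cvg_scalar F l r (u : T -> R) (c : R) {FF : Filter F} :
  u e @[e --> F] --> c -> unif_cvg F l r (fun e _ => u e) (fun=> c).
Proof.
move=> /cvgrPdist_lt H d d0; near=> e => x _.
by rewrite distrC; near: e; exact: H.
Unshelve. all: by end_near. Qed.

Lemma unif_cvgD F l r f_ f g_ g {FF : Filter F} : unif_cvg F l r f_ f ->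
  unif_cvg F l r g_ g ->
  unif_cvg F l r (fun e x => f_ e x + g_ e x) (fun x => f x + g x).
Proof.
move=> Hf Hg d d0; have d2 : 0 < d / 2 by lra.
near=> e => x xl.
have H1 : `|f_ e x - f x| < d / 2 by move: x xl; near: e; exact: Hf.
have H2 : `|g_ e x - g x| < d / 2 by move: x xl {H1}; near: e; exact: Hg.
have -> : f_ e x + g_ e x - (f x + g x) = (f_ e x - f x) + (g_ e x - g x) by ring.
by apply: le_lt_trans (ler_normD _ _) _; lra.
Unshelve. all: by end_near. Qed.

Lemma unif_cvgM F l r f_ f g_ g (A B : R) {FF : Filter F} :
  (forall x, x \in `[l, r] -> `|f x| <= A) ->
  (forall x, x \in `[l, r] -> `|g x| <= B) ->
  unif_cvg F l r f_ f -> unif_cvg F l r g_ g ->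
  unif_cvg F l r (fun e x => f_ e x * g_ e x) (fun x => f x * g x).
Proof.
move=> fA gB Hf Hg d d0.
(* The error is at most d'^2 + |A| d' + d' |B|, which is at most d' k because d' <= 1, hence at most
   d / 2. *)
pose k := `|A| + `|B| + 1.
have k0 : 0 < k by rewrite /k ltr_wpDl// addr_ge0.
pose d' := Num.min 1 (d / (2 * k)).
have d'0 : 0 < d' by rewrite lt_min ltr01/= divr_gt0// mulr_gt0.
have d'1 : d' <= 1 by rewrite ge_min lexx.
have d'2 : d' * (2 * k) <= d by rewrite -ler_pdivlMr ?mulr_gt0// ge_min lexx orbT.
near=> e => x xl.
have H1 : `|f_ e x - f x| < d' by move: x xl; near: e; exact: Hf.
have H2 : `|g_ e x - g x| < d' by move: x xl {H1}; near: e; exact: Hg.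
have -> : f_ e x * g_ e x - f x * g x =
  (f_ e x - f x) * (g_ e x - g x) + f x * (g_ e x - g x) + (f_ e x - f x) * g x by ring.
apply: le_lt_trans (ler_normD _ _) _.
apply: le_lt_trans (lerD (ler_normD _ _) (lexx _)) _.
rewrite !normrM.
have fA' : `|f x| <= `|A| by apply: le_trans (fA x xl) (ler_norm _).
have gB' : `|g x| <= `|B| by apply: le_trans (gB x xl) (ler_norm _).
move: (`|f x|) (`|g x|) (normr_ge0 (f x)) (normr_ge0 (g x)) fA' gB' H1 H2
  (normr_ge0 (f_ e x - f x)) (normr_ge0 (g_ e x - g x)).
move: (`|f_ e x - f x|) (`|g_ e x - g x|) => u v a b a0 b0 aA bB ud vd u0 v0.
have A0 := normr_ge0 A; have B0 := normr_ge0 B.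
move: d'2; rewrite /k; move: (`|A|) (`|B|) A0 B0 aA bB => a1 b1 A0 B0 aA bB d'2.
have h1 : u * v <= d' * 1 by apply: ler_pM => //; [exact: ltW|lra].
have h2 : a * v <= a1 * d' by apply: ler_pM => //; exact: ltW.
have h3 : u * b <= d' * b1 by apply: ler_pM => //; exact: ltW.
lra.
Unshelve. all: by end_near. Qed.

Lemma unif_cvg_within F l r f_ f {FF : ProperFilter F} :
  unif_cvg F l r f_ f ->
  (\forall e \near F, {within `[l, r], continuous (f_ e)}) ->
  {within `[l, r], continuous f}.
Proof.
move=> H cf; apply/within_itv_contP => x xl d d0.
have d3 : 0 < d / 3 by lra.
have [e [He ce]] := filter_ex (filterI (H _ d3) cf).
have /within_itv_contP /(_ x xl _ d3) [s s0 Hs] := ce.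
exists s => // y yl yx.
have := Hs y yl yx; have := He y yl; have := He x xl.
rewrite !ltr_norml => /andP[? ?] /andP[? ?] /andP[? ?]; apply/andP; split; lra.
Qed.

(** Let P be the primitive of df. The derivative df_e - df of f_e - P is uniformly small, so f_e - P
    is nearly constant; in the limit f = f(l) + P, which is differentiable with derivative df. *)
Lemma unif_cvg_derive F l r f_ f df_ df {FF : ProperFilter F} : l < r ->
  unif_cvg F l r f_ f -> unif_cvg F l r df_ df ->
  (\forall e \near F, {within `[l, r], continuous (f_ e)}) ->
  (\forall e \near F, {within `[l, r], continuous (df_ e)}) ->
  (\forall e \near F, forall x, x \in `]l, r[ -> is_derive x 1 (f_ e) (df_ e x)) ->
  forall x, x \in `]l, r[ -> is_derive x 1 f (df x).
Proof.
move=> lr Hf Hdf cf cdf fd.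
have cdf' : {within `[l, r], continuous df} by exact: unif_cvg_within Hdf cdf.
pose P x := \int[@lebesgue_measure R]_(t in `[l, x]) df t.
have [cP dP] : {within `[l, r], continuous P} /\
    forall x, x \in `]l, r[ -> is_derive x 1 P (df x) by exact: primitive_within.
have ll : l \in `[l, r] by rewrite in_itv /= lexx ltW.
have Pl : P l = 0 by rewrite /P set_itv1 Rintegral_set1.
have fP y : y \in `[l, r] -> f y = f l + P y.
  move=> yl; apply/eqP; rewrite -subr_eq0 -normr_eq0; apply/eqP.
  apply/eqP; rewrite eq_le normr_ge0 andbT; apply/ler_addgt0Pr => d d0.
  have d3 : 0 < d / 3 by lra.
  have rl : 0 < r - l by lra.
  have dl : 0 < d / 3 / (r - l) by exact: divr_gt0.
  have [e [[[[/= H1 H2] H3] H4] H5]] := filter_ex (filterI (filterI (filterI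
    (filterI (Hf _ d3) (Hdf _ dl)) cf) cdf) fd).
  have := @mvt_lipschitz R l r (fun x => f_ e x - P x) (fun x => df_ e x - df x)
   (d / 3 / (r - l)) (within_sub H3 cP)
   (fun z zl => is_derive_sub (H5 z zl) (dP z zl))
   (fun z zl => ltW (H2 z (subset_itv_oo_cc zl))) y l yl ll.
  have yle : `|y - l| <= r - l.
    by move: yl; rewrite in_itv /= => /andP[? ?]; rewrite ger0_norm; lra.
  have : d / 3 / (r - l) * `|y - l| <= d / 3.
    by rewrite -[leRHS](@divfK _ (r - l)) ?gt_eqF// ler_wpM2l// ltW.
  move=> h1 h2; have := le_trans h2 h1; have := H1 y yl; have := H1 l ll.
  rewrite Pl subr0 !ltr_norml !ler_norml => /andP[? ?] /andP[? ?] /andP[? ?].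
  by apply/andP; split; lra.
move=> x xl.
have := is_derive_add (is_derive_cst (f l) x 1) (dP x xl); rewrite add0r.
apply: near_eq_is_derive; near=> z.
apply: esym; rewrite (fP z)//; apply: subset_itv_oo_cc; near: z.
exact: near_in_itvoo.
Unshelve. all: by end_near. Qed.

End ultra.

(** * Limits of solutions *)

Section ode_limits.
Context {R : realType} {T : Type}.
Implicit Types (F : set_system T) (D : nat -> R -> R) (l r : R).

Definition solves (l r : R) (q : R -> R) D :=
  derivatives_on 4 l r D /\ forall x, x \in `[l, r] -> D 4%N x = q x * D 0%N x.

Lemma derivatives_scale n l r D (c : R) : derivatives_on n l r D ->
  derivatives_on n l r (fun k x => c * D k x).
Proof.
move=> [cD dD]; split=> k kn.
  by apply: within_mul; [exact: within_cst|exact: cD].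
by move=> x xl; exact: is_derive_scale (dD k kn x xl).
Qed.

Lemma solves_scale l r q D (c : R) : solves l r q D ->
  solves l r q (fun k x => c * D k x).
Proof.
move=> [dD HD]; split; first exact: derivatives_scale.
by move=> x xl /=; rewrite HD// mulrCA.
Qed.

Lemma unif_cvg_eq F l r (f_ g_ : T -> R -> R) f {FF : Filter F} :
  (\forall e \near F, forall x, x \in `[l, r] -> f_ e x = g_ e x) ->
  unif_cvg F l r g_ f -> unif_cvg F l r f_ f.
Proof.
move=> fg H d d0; apply: filterS2 fg (H d d0) => e fg H' x xl.
by rewrite fg// H'.
Qed.

Lemma gronwall_solution l r q D (M B x0 : R) : l < r -> x0 \in `[l, r] ->
  solves l r q D -> (forall x, x \in `[l, r] -> `|q x| <= M) ->
  (forall k, (k < 4)%N -> `|D k x0| <= B) ->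
  forall k x, (k < 4)%N -> x \in `[l, r] ->
  `|D k x| <= Num.sqrt (expR ((3 + 2 * M ^+ 2) * (r - l)) * (4 * B ^+ 2)).
Proof.
move=> lr x0l [dD HD] qM DB k x k4 xl.
have M0 : 0 <= M by apply: le_trans (qM x0 x0l).
have H4 y : y \in `[l, r] -> `|D 4%N y| <= M * `|D 0%N y| + 0.
  by move=> yl; rewrite HD// addr0 normrM ler_wpM2r// qM.
have := gronwall dD M0 (lexx 0) H4 xl x0l.
rewrite expr0n !addr0 => H.
apply: le_trans (le_energy _ _ k4) _; rewrite ler_wsqrtr//.
by apply: le_trans H _; rewrite ler_wpM2l ?expR_ge0// energy_le.
Qed.

(** The difference solves the first equation with right-hand side (q1 - q2) D2, of size at most s.
    The energy at x0 is at most 4 s^2, and the added s^2 makes it 5 s^2; since the exponential X is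
    at least 1, 5 X s^2 <= (5 X s)^2. *)
Lemma gronwall_difference l r q1 q2 D1 D2 (M C s x0 : R) : l < r ->
  x0 \in `[l, r] -> 0 <= s -> solves l r q1 D1 -> solves l r q2 D2 ->
  (forall x, x \in `[l, r] -> `|q1 x| <= M) ->
  (forall x, x \in `[l, r] -> `|D2 0%N x| <= C) ->
  (forall x, x \in `[l, r] -> `|q1 x - q2 x| * C <= s) ->
  (forall k, (k < 4)%N -> `|D1 k x0 - D2 k x0| <= s) ->
  forall k x, (k < 4)%N -> x \in `[l, r] ->
  `|D1 k x - D2 k x| <= 5 * expR ((3 + 2 * M ^+ 2) * (r - l)) * s.
Proof.
move=> lr x0l s0 [dD1 HD1] [dD2 HD2] qM DC qC D12 k x k4 xl.
have M0 : 0 <= M by apply: le_trans (qM x0 x0l).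
pose D := (fun k x => 1 * D1 k x + (-1) * D2 k x) : nat -> R -> R.
have DE j y : D j y = D1 j y - D2 j y by rewrite /D mul1r mulN1r.
have dD : derivatives_on 4 l r D by exact: derivatives_lin.
have H4 y : y \in `[l, r] -> `|D 4%N y| <= M * `|D 0%N y| + s.
  move=> yl; rewrite !DE HD1// HD2//.
  have -> : q1 y * D1 0%N y - q2 y * D2 0%N y =
    q1 y * (D1 0%N y - D2 0%N y) + (q1 y - q2 y) * D2 0%N y by ring.
  apply: le_trans (ler_normD _ _) _; rewrite !normrM; apply: lerD.
    by rewrite ler_wpM2r// qM.
  by apply: le_trans (qC y yl); rewrite ler_wpM2l// DC.
have := gronwall dD M0 s0 H4 xl x0l.
set X := expR _ => H; rewrite -DE.
have X1 : 1 <= X.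
  rewrite /X -[leLHS]expR0 ler_expR mulr_ge0//; first by have := sqr_ge0 M; lra.
  by rewrite subr_ge0 ltW.
have E0 : energy D x0 <= 4 * s ^+ 2 by apply: energy_le => j j4; rewrite DE D12.
have : energy D x <= (5 * X * s) ^+ 2.
  have h1 : energy D x <= X * (5 * s ^+ 2).
    apply: (@le_trans _ _ (energy D x + s ^+ 2)); first by rewrite lerDl sqr_ge0.
    apply: le_trans H _; rewrite ler_pM2l ?expR_gt0//.
    by move: E0; move: (energy D x0) (s ^+ 2) => u v; lra.
  apply: le_trans h1 _.
  have -> : (5 * X * s) ^+ 2 = X * (5 * s ^+ 2) * (5 * X) by ring.
  rewrite ler_peMr ?mulr_ge0 ?sqr_ge0 ?expR_ge0//; lra.
move=> /ler_wsqrtr; rewrite sqrtr_sqr ger0_norm; last by rewrite !mulr_ge0//; lra.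
by apply: le_trans; exact: le_energy.
Qed.

(** Gronwall bounds the solutions, so pointwise limits exist along the ultrafilter. Convergence of
    the data at x0 and of the coefficients makes the family uniformly Cauchy, by the estimate for
    differences; this replaces an equicontinuity argument. *)
Lemma ode_compactness F l r (x0 : R) (D_ : T -> nat -> R -> R) q_ q (M B : R)
    {FU : UltraFilter F} : l < r -> x0 \in `[l, r] ->
  (forall x, x \in `[l, r] -> `|q x| <= M) -> unif_cvg F l r q_ q ->
  (\forall e \near F, solves l r (q_ e) (D_ e)) ->
  (\forall e \near F, forall k, (k < 4)%N -> `|D_ e k x0| <= B) ->
  exists2 Z, solves l r q Z &
    forall k, (k <= 4)%N -> unif_cvg F l r (fun e => D_ e k) (Z k).
Proof.
move=> lr x0l qM Hq HD HB.
have q1 : \forall e \near F, forall x, x \in `[l, r] -> `|q_ e x| <= M + 1.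
  apply: filterS (Hq _ ltr01) => e H x xl.
  have -> : q_ e x = q x + (q_ e x - q x) by ring.
  by apply: le_trans (ler_normD _ _) _; rewrite lerD ?qM// ltW// H.
pose X := expR ((3 + 2 * (M + 1) ^+ 2) * (r - l)).
pose C := Num.sqrt (X * (4 * B ^+ 2)).
have C0 : 0 <= C by exact: sqrtr_ge0.
have X0 : 0 < X by exact: expR_gt0.
have DC : \forall e \near F, forall k x, (k < 4)%N -> x \in `[l, r] ->
    `|D_ e k x| <= C.
  apply: filterS3 HD q1 HB => e H1 H2 H3.
  exact: gronwall_solution lr x0l H1 H2 H3.
(* Limits are chosen for all pairs (k, x) at once, with the dummy value 0 outside the range of
   interest. *)
have /choice [Z HZ] : forall kx : nat * R, exists c : R,
    (kx.1 < 4)%N -> kx.2 \in `[l, r] -> D_ e kx.1 kx.2 @[e --> F] --> c.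
  move=> [k x] /=; have [k4|k4] := boolP (k < 4)%N; last by exists 0.
  have [xl|xl] := boolP (x \in `[l, r]); last by exists 0.
  have [c Hc] := @ultra_bounded_cvg _ _ F (fun e => D_ e k x) C FU
    (filterS (fun e H => H k x k4 xl) DC).
  by exists c.
have cauchy d : 0 < d -> \forall e \near F, \forall e' \near F,
    forall k x, (k < 4)%N -> x \in `[l, r] -> `|D_ e k x - D_ e' k x| <= d.
  move=> d0; pose s := d / (5 * X).
  have s0 : 0 < s by rewrite divr_gt0// mulr_gt0.
  (* With each coefficient this close to q, two of them differ by at most s / (C + 1), which times
     the bound C of the solutions stays below s. *)
  have s1 : 0 < s / (2 * (C + 1)) by rewrite divr_gt0// mulr_gt0//; lra.
  have s2 : 0 < s / 2 by lra.
  have HZ' k : (k < 4)%N -> \forall e \near F, `|Z (k, x0) - D_ e k x0| < s / 2.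
    by move=> k4; have /cvgrPdist_lt := HZ (k, x0) k4 x0l; exact.
  have good : \forall e \near F, [/\ solves l r (q_ e) (D_ e),
     (forall x, x \in `[l, r] -> `|q_ e x| <= M + 1),
     (forall x, x \in `[l, r] -> `|q_ e x - q x| < s / (2 * (C + 1))),
     (forall x, x \in `[l, r] -> `|D_ e 0%N x| <= C) &
     (forall k, (k < 4)%N -> `|Z (k, x0) - D_ e k x0| < s / 2)].
    near=> e; split.
    - by near: e.
    - by near: e.
    - by near: e; exact: Hq.
    - by near: e; apply: filterS DC => e H x xl; exact: H.
    - move=> [|[|[|[|//]]]] _.
      + by near: e; exact: HZ'.
      + by near: e; exact: HZ'.
      + by near: e; exact: HZ'.
      + by near: e; exact: HZ'.
  apply: filterS (good) => e [e1 e2 e3 e4 e5].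
  apply: filterS (good) => e' [f1 f2 f3 f4 f5] k x k4 xl.
  have -> : d = 5 * X * s by rewrite /s mulrC divfK// gt_eqF// mulr_gt0.
  apply: (gronwall_difference lr x0l (ltW s0) e1 f1 e2 f4 _ _ k4 xl) => [y yl|j j4].
    have h : `|q_ e y - q_ e' y| <= s / (C + 1).
      have -> : q_ e y - q_ e' y = (q_ e y - q y) - (q_ e' y - q y) by ring.
      apply: le_trans (ler_normB _ _) _.
      have := e3 y yl; have := f3 y yl.
      have -> : s / (2 * (C + 1)) = s / (C + 1) / 2 by field; lra.
      lra.
    apply: le_trans (ler_wpM2r C0 h) _.
    rewrite -mulrA ger_pMr// mulrC ler_pdivrMr; lra.
  have -> : D_ e j x0 - D_ e' j x0 =
    (Z (j, x0) - D_ e' j x0) - (Z (j, x0) - D_ e j x0) by ring.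
  apply: le_trans (ler_normB _ _) _.
  have := e5 j j4; have := f5 j j4; lra.
have HZu k : (k < 4)%N -> unif_cvg F l r (fun e => D_ e k) (fun x => Z (k, x)).
  move=> k4 d d0; have d3 : 0 < d / 3 by lra.
  apply: filterS (cauchy _ d3) => e He x xl.
  have /cvgrPdist_lt /(_ _ d3) H := HZ (k, x) k4 xl.
  have [e' [/= h1 h2]] := filter_ex (filterI He H).
  have -> : D_ e k x - Z (k, x) = (D_ e k x - D_ e' k x) - (Z (k, x) - D_ e' k x) by ring.
  apply: le_lt_trans (ler_normB _ _) _.
  have := h1 k x k4 xl; lra.
(* Gronwall controls only the orders below 4; the fourth derivative is read off from the
   equation. *)
pose W k x := if (k == 4)%N then q x * Z (0, x) else Z (k, x).
have cD k : (k <= 4)%N -> \forall e \near F, {within `[l, r], continuous (D_ e k)}.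
  by move=> k4; apply: filterS HD => e [[H _] _]; exact: H.
have cZ0 : {within `[l, r], continuous (fun x => Z (0, x))}.
  exact: (unif_cvg_within (HZu 0%N isT) (cD 0%N isT)).
have [A A0 ZA] := within_bounded cZ0.
have HWu k : (k <= 4)%N -> unif_cvg F l r (fun e => D_ e k) (W k).
  rewrite leq_eqVlt => /predU1P[->|k4]; last first.
    have -> : W k = fun x => Z (k, x) by apply/funext => x; rewrite /W (ltn_eqF k4).
    exact: HZu.
  apply: (@unif_cvg_eq F l r _ (fun e x => q_ e x * D_ e 0%N x)).
    by apply: filterS HD => e [_ H]; exact: H.
  exact: (unif_cvgM qM ZA Hq (HZu 0%N isT)).
exists W => //; split; last by move=> x xl.
split=> k k4; first exact: (unif_cvg_within (HWu k k4) (cD k k4)).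
apply: (unif_cvg_derive lr (HWu k (ltnW k4)) (HWu k.+1 k4) (cD k (ltnW k4)) (cD k.+1 k4)).
by apply: filterS HD => e [[_ H] _]; exact: H.
Unshelve. all: by end_near. Qed.

(* If the data were unbounded, normalizing them to size 1 would produce, in the
   limit, a nonzero solution Z with s_e D_e -> Z and s_e -> 0. *)
Lemma ode_data_bounded F l r (x0 : R) (D_ : T -> nat -> R -> R) q_ q (M : R)
    {FU : UltraFilter F} : l < r -> x0 \in `[l, r] ->
  (forall x, x \in `[l, r] -> `|q x| <= M) -> unif_cvg F l r q_ q ->
  (\forall e \near F, solves l r (q_ e) (D_ e)) ->
  (forall (s : T -> R) Z, (\forall e \near F, 0 < s e) ->
    s e @[e --> F] --> 0 -> solves l r q Z ->
    (forall k, (k <= 4)%N -> unif_cvg F l r (fun e x => s e * D_ e k x) (Z k)) ->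
    forall x, x \in `[l, r] -> Z 0%N x = 0) ->
  exists B, \forall e \near F, forall k, (k < 4)%N -> `|D_ e k x0| <= B.
Proof.
move=> lr x0l qM Hq HD obs.
pose rho e := `|D_ e 0%N x0| + `|D_ e 1%N x0| + `|D_ e 2%N x0| + `|D_ e 3%N x0|.
have le_rho e k : (k < 4)%N -> `|D_ e k x0| <= rho e.
  have := (normr_ge0 (D_ e 0%N x0), normr_ge0 (D_ e 1%N x0),
           normr_ge0 (D_ e 2%N x0), normr_ge0 (D_ e 3%N x0)).
  by rewrite /rho; case: k => [|[|[|[|]]]]// [[[]]]; lra.
have [[B HB]|Hinf] := @ultra_unbounded _ _ F rho FU.
  by exists B; apply: filterS HB => e H k k4; exact: le_trans (le_rho e k k4) H.
exfalso.
have rho0 := Hinf 0.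
pose s e := (rho e)^-1.
have s0 : \forall e \near F, 0 < s e.
  by apply: filterS rho0 => e; rewrite /s invr_gt0.
have scvg : s e @[e --> F] --> (0 : R).
  apply/cvgrPdist_lt => d d0; apply: filterS2 rho0 (Hinf d^-1) => e e0 He.
  by rewrite sub0r normrN gtr0_norm ?invr_gt0// /s invf_plt// posrE.
have [||Z sZ HZ] := @ode_compactness F l r x0 (fun e k x => s e * D_ e k x) q_ q M 1 FU
    lr x0l qM Hq.
- by apply: filterS HD => e; exact: solves_scale.
- apply: filterS rho0 => e e0 k k4.
  by rewrite normrM gtr0_norm ?invr_gt0// /s mulrC ler_pdivrMr// mul1r le_rho.
have Z0 := obs s Z s0 scvg sZ HZ.
(* If Z vanishes, the four scaled data are each eventually below 1/4, while their sum is 1 by the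
   choice of s. *)
have Zk k : (k < 4)%N -> \forall e \near F, `|s e * D_ e k x0| < 1 / 4.
  move=> k4; have h4 : 0 < 1 / 4 :> R by lra.
  apply: filterS (HZ k (ltnW k4) _ h4) => e /(_ x0 x0l).
  by rewrite (derivatives_zero lr (sZ.1) Z0 (ltnW k4) x0l) subr0.
have [e [[[[/= h0 h1] h2] h3] hr]] := filter_ex (filterI (filterI (filterI (filterI
  (Zk 0%N isT) (Zk 1%N isT)) (Zk 2%N isT)) (Zk 3%N isT)) rho0).
have : s e * rho e = 1 by rewrite mulVf// gt_eqF.
have : s e * rho e = `|s e * D_ e 0%N x0| + `|s e * D_ e 1%N x0| +
    `|s e * D_ e 2%N x0| + `|s e * D_ e 3%N x0|.
  by rewrite !normrM gtr0_norm ?invr_gt0// /rho; ring.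
lra.
Qed.

End ode_limits.

(** * The region outside the support of the potential *)

Section outer.
Context {R : realType} {T : Type}.
Implicit Types (F : set_system T) (D : nat -> R -> R) (l r : R).
Local Notation mu := (@lebesgue_measure R).

Lemma cvg_exprn F (u : T -> R) (c : R) n {FF : Filter F} :
  u e @[e --> F] --> c -> u e ^+ n @[e --> F] --> c ^+ n.
Proof. by move=> H; exact: (cvg_comp _ _ H (@exprn_continuous R n c)). Qed.

Lemma near_cvg F (u w : T -> R) (c : R) {FF : Filter F} :
  (\forall e \near F, u e = w e) -> u e @[e --> F] --> c -> w e @[e --> F] --> c.
Proof.
move=> uw H; apply: cvg_trans H.
exact: (@near_eq_cvg _ _ F FF u w).
Qed.

Lemma within_exprn2 l r (f : R -> R) : {within `[l, r], continuous f} ->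
  {within `[l, r], continuous (fun x => f x ^+ 2)}.
Proof.
move=> cf; have := within_mul cf cf.
by have -> : (fun x => f x * f x) = (fun x => f x ^+ 2) by [].
Qed.

Lemma integral_itv_lower_bound l r p p' (f : R -> R) (c : R) :
  {within `[l, r], continuous f} -> l <= p -> p < p' -> p' <= r -> 0 <= c ->
  (forall x, x \in `[l, r] -> 0 <= f x) ->
  (forall x, x \in `[p, p'] -> c <= f x) ->
  ((c * (p' - p))%:E <= \int[mu]_(x in `[l, r]) (f x)%:E)%E.
Proof.
move=> cf lp pp' p'r c0 f0 cf_le.
have mf := measurable_int mu (continuous_integrable cf).
have sub : `[p, p'] `<=` `[l, r] by apply: subset_itv; rewrite bnd_simp.
apply: (@le_trans _ _ (\int[mu]_(x in `[p, p']) (f x)%:E)%E); last first.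
  by apply: ge0_subset_integral => // x /= xl; rewrite lee_fin f0.
have muE : mu `[p, p'] = (p' - p)%:E.
  by rewrite lebesgue_measure_itv/= lte_fin pp' -EFinB.
have -> : (c * (p' - p))%:E = (\int[mu]_(x in `[p, p']) (cst c%:E x))%E.
  rewrite (integral_cst mu (measurable_itv `[p, p'])).
  by rewrite EFinM; congr (_ * _)%E; exact: esym muE.
by apply: ge0_le_integral => //; exact: measurable_funS mf.
Qed.

(** If the blow-up limit Z were nonzero at x, then |Z| > d on an interval of some length h, so |D_e|
    >= d / (2 s_e) there. Its squared L_2 norm would be at least (d / 2)^2 h / s_e^2, which exceeds
    1 as s_e tends to 0. *)
Lemma l2_data_bounded F l r (x0 : R) (D_ : T -> nat -> R -> R) q_ q (M : R)
    {FU : UltraFilter F} : l < r -> x0 \in `[l, r] ->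
  (forall x, x \in `[l, r] -> `|q x| <= M) -> unif_cvg F l r q_ q ->
  (\forall e \near F, solves l r (q_ e) (D_ e)) ->
  (\forall e \near F, (\int[mu]_(x in `[l, r]) (D_ e 0%N x ^+ 2)%:E <= 1)%E) ->
  exists B, \forall e \near F, forall k, (k < 4)%N -> `|D_ e k x0| <= B.
Proof.
move=> lr x0l qM Hq HD Hint; apply: (ode_data_bounded lr x0l qM Hq HD).
move=> s Z s0 scvg [[cZ dZ] _] HZ x xl; apply: contrapT => /eqP Zx.
have /within_itv_contP /(_ x xl) cx := cZ 0%N isT.
have d0 : 0 < `|Z 0%N x| / 2 by rewrite divr_gt0// normr_gt0.
set d := `|Z 0%N x| / 2 in d0.
have [eta eta0 Heta] := cx d d0.
(* As h is at most half the length of [l, r], an interval of length h starting or ending at x fits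
   inside. *)
pose h := Num.min (eta / 2) ((r - l) / 2).
have rl : 0 < r - l by lra.
have h0 : 0 < h by rewrite lt_min !divr_gt0.
have h1 : h <= eta / 2 by rewrite ge_min lexx.
have h2 : h <= (r - l) / 2 by rewrite ge_min lexx orbT.
have [p [lp pr px]] : exists p, [/\ l <= p, p + h <= r & p <= x <= p + h].
  move: xl; rewrite in_itv /= => /andP[lx xr].
  have [hx|hx] := leP x ((l + r) / 2).
    by exists x; split; rewrite ?lexx ?lerDl ?(ltW h0)//; lra.
  by exists (x - h); split; [lra|lra|rewrite subrK lexx andbT; lra].
have Zp y : y \in `[p, p + h] -> d < `|Z 0%N y|.
  move=> yp; have yl : y \in `[l, r].
    move: yp; rewrite !in_itv /= => /andP[? ?]; apply/andP; split; lra.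
  have : `|y - x| < eta.
    move: yp px; rewrite in_itv /= => /andP[? ?] /andP[? ?].
    by rewrite ltr_norml; apply/andP; split; lra.
  move=> /(Heta y yl) H; have := lerB_dist (Z 0%N x) (Z 0%N x - Z 0%N y).
  rewrite subKr distrC => H2; have : `|Z 0%N x| = d + d by rewrite /d; lra.
  lra.
have d2 : 0 < d / 2 by lra.
have dh : 0 < (d / 2) ^+ 2 * h by rewrite mulr_gt0// exprn_gt0.
have sc2 : s e ^+ 2 @[e --> F] --> (0 : R) ^+ 2 by exact: cvg_exprn.
have /cvgrPdist_lt /(_ _ dh) H1 := sc2.
have [e [[[[/= He1 He2] He3] He4] [[cD _] _]]] := filter_ex (filterI (filterI (filterI
  (filterI H1 s0) (HZ 0%N isT _ d2)) Hint) HD).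
rewrite expr0n /= sub0r normrN ger0_norm ?sqr_ge0// in He1.
have low y : y \in `[p, p + h] -> (d / 2 / s e) ^+ 2 <= D_ e 0%N y ^+ 2.
  move=> yp; have yl : y \in `[l, r].
    move: yp; rewrite !in_itv /= => /andP[? ?]; apply/andP; split; lra.
  rewrite -[D_ e 0%N y ^+ 2]real_normK ?num_real// lerXn2r ?nnegrE//.
    by rewrite divr_ge0// ltW.
  rewrite ler_pdivrMr// [leRHS]mulrC -[s e]gtr0_norm// -normrM.
  have := Zp y yp; have := He3 y yl.
  have := lerB_dist (Z 0%N y) (Z 0%N y - s e * D_ e 0%N y); rewrite subKr distrC.
  lra.
have php : p < p + h by rewrite ltrDl.
have := integral_itv_lower_bound (within_exprn2 (cD 0%N isT)) lp php pr (sqr_ge0 _)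
  (fun x _ => sqr_ge0 _) low.
move=> /le_trans /(_ He4); rewrite lee_fin addrAC subrr add0r.
rewrite expr_div_n mulrAC ler_pdivrMr ?exprn_gt0// mul1r; lra.
Qed.

Lemma derivative_lipschitz l r D : derivatives_on 1 l r D ->
  exists2 C, 0 <= C & forall x y, x \in `[l, r] -> y \in `[l, r] ->
    `|D 0%N x - D 0%N y| <= C * `|x - y|.
Proof.
move=> [cD dD]; have [C C0 HC] := within_bounded (cD 1%N isT).
exists C => // x y xl yl.
apply: (mvt_lipschitz (cD 0%N isT) (dD 0%N isT)) => // z zl.
by apply: HC; exact: subset_itv_oo_cc zl.
Qed.

(* The affine map s |-> x0 + rho_e (s - x0) sends [l, r] onto the interval where
   the equation holds, so that the solutions get a common domain; rho_e -> 1. *)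
Lemma outer_limit F l r (x0 : R) (rho lam : T -> R) (lambda : R) (U : R -> R)
    (CU MU B : R) (D_ : T -> nat -> R -> R) {FU : UltraFilter F} :
  l < r -> x0 \in `[l, r] ->
  (forall x, x \in `[l, r] -> `|U x| <= MU) ->
  0 <= CU ->
  (forall x y, x \in `[l, r] -> y \in `[l, r] -> `|U x - U y| <= CU * `|x - y|) ->
  lam e @[e --> F] --> lambda -> rho e @[e --> F] --> (1 : R) ->
  (\forall e \near F, 0 < rho e <= 1) ->
  (\forall e \near F, solves (x0 + rho e * (l - x0)) (x0 + rho e * (r - x0))
      (fun x => lam e - U x) (D_ e)) ->
  (\forall e \near F, forall k, (k < 4)%N -> `|D_ e k x0| <= B) ->
  exists Z, [/\ solves l r (fun x => lambda - U x) Z,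
   (forall k, (k <= 4)%N -> forall s, s \in `[l, r] ->
      D_ e k (x0 + rho e * (s - x0)) @[e --> F] --> Z k s) &
   forall d, 0 < d -> \forall e \near F, forall x,
     x \in `[x0 + rho e * (l - x0), x0 + rho e * (r - x0)] ->
     `|D_ e 0%N x - Z 0%N x| < d].
Proof.
move=> lr x0l UM CU0 UC lamc rhoc rho01 HD HB.
have x0lr : l <= x0 <= r by move: x0l; rewrite in_itv.
have shrink (p : R) s : 0 < p <= 1 -> s \in `[l, r] -> x0 + p * (s - x0) \in `[l, r].
  move=> /andP[p0 p1]; move: x0lr; rewrite !in_itv /= => /andP[? ?] /andP[? ?].
  by apply/andP; split; nra.
have near_id (p : R) s : 0 < p <= 1 -> s \in `[l, r] ->
    `|x0 + p * (s - x0) - s| <= (1 - p) * (r - l).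
  move=> /andP[p0 p1]; move: x0lr; rewrite in_itv /= => /andP[? ?] /andP[? ?].
  have -> : x0 + p * (s - x0) - s = (1 - p) * (x0 - s) by ring.
  rewrite normrM ger0_norm ?subr_ge0// ler_wpM2l ?subr_ge0//.
  by rewrite ler_norml; apply/andP; split; lra.
(* The factor rho^4 comes from four applications of the chain rule. *)
pose q_ e s := rho e ^+ 4 * (lam e - U (x0 + rho e * (s - x0))).
pose q s := lambda - U s.
pose z_ e k s := 1 * rho e ^+ k * D_ e k ((x0 - rho e * x0) + rho e * s).
have AE p s : (x0 - p * x0) + p * s = x0 + p * (s - x0) :> R by ring.
have qM s : s \in `[l, r] -> `|q s| <= `|lambda| + MU.
  by move=> sl; apply: le_trans (ler_normB _ _) _; rewrite lerD2l UM.
have UA : unif_cvg F l r (fun e s => U (x0 + rho e * (s - x0))) U.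
  move=> d d0; pose k := CU * (r - l) + 1.
  have k0 : 0 < k by rewrite ltr_wpDl// mulr_ge0//; lra.
  have dk : 0 < d / k by rewrite divr_gt0.
  have /cvgrPdist_lt /(_ _ dk) Hr := rhoc.
  apply: filterS2 Hr rho01 => e He r01 s sl.
  apply: le_lt_trans (UC _ _ (shrink _ _ r01 sl) sl) _.
  apply: le_lt_trans (ler_wpM2l CU0 (near_id _ _ r01 sl)) _.
  rewrite ger0_norm in He; last by case/andP: r01; lra.
  move: He; rewrite ltr_pdivlMr// /k; case/andP: r01; nra.
have Hq : unif_cvg F l r q_ q.
  have H1 : unif_cvg F l r (fun e _ => rho e ^+ 4) (fun=> 1).
    have r4 : rho e ^+ 4 @[e --> F] --> (1 : R) ^+ 4 by exact: cvg_exprn.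
    by rewrite expr1n in r4; exact: unif_cvg_scalar.
  have HU : unif_cvg F l r (fun e s => - U (x0 + rho e * (s - x0))) (fun s => - U s).
    move=> d d0; apply: filterS (UA d d0) => e He s sl.
    by rewrite -opprD normrN He.
  have H2 : unif_cvg F l r (fun e s => lam e - U (x0 + rho e * (s - x0))) q.
    exact: unif_cvgD (unif_cvg_scalar l r lamc) HU.
  have b1 x : x \in `[l, r] -> `|1 : R| <= 1 by rewrite normr1.
  have H3 : unif_cvg F l r q_ (fun x => 1 * q x) by exact: unif_cvgM b1 qM H1 H2.
  by have <- : (fun x => 1 * q x) = q by apply/funext => x; rewrite mul1r.
have Hz : \forall e \near F, solves l r (q_ e) (z_ e).
  apply: filterS2 rho01 HD => e r01 [dD HDe]; have /andP[r0 r1] := r01; split.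
    apply: derivatives_affine dD => //; rewrite AE; exact: lexx.
  move=> s sl; rewrite /z_ /q_ !AE HDe; last first.
    move: sl; rewrite !in_itv /= => /andP[? ?].
    by rewrite !lerD2l !ler_pM2l// !lerD2r; apply/andP.
  by rewrite expr0; ring.
have HzB : \forall e \near F, forall k, (k < 4)%N -> `|z_ e k x0| <= B.
  apply: filterS2 rho01 HB => e /andP[r0 r1] H k k4.
  rewrite /z_ AE subrr mulr0 addr0 mul1r normrM.
  apply: le_trans (H k k4); rewrite ler_piMl// ger0_norm ?exprn_ge0 ?(ltW r0)//.
  by rewrite exprn_ile1 ?(ltW r0).
have [Z sZ HZ] := ode_compactness lr x0l qM Hq Hz HzB.
exists Z; split => //.
  move=> k k4 s sl.
  have Hk : z_ e k s @[e --> F] --> Z k s by exact: unif_cvg_at (HZ k k4) sl.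
  have r1 : (rho e ^+ k)^-1 @[e --> F] --> (1 : R).
    have H1 : rho e ^+ k @[e --> F] --> (1 : R) ^+ k by exact: cvg_exprn.
    rewrite expr1n in H1; have H2 := cvgV (oner_neq0 R) H1.
    by rewrite invr1 in H2; exact: H2.
  have H3 : (rho e ^+ k)^-1 * z_ e k s @[e --> F] --> Z k s.
    by rewrite -(mul1r (Z k s)); exact: cvgM.
  apply: near_cvg H3; apply: filterS rho01 => e /andP[r0 _].
  by rewrite /z_ /= AE mul1r mulKf// gt_eqF// exprn_gt0.
move=> d d0.
have [C C0 HC] := derivative_lipschitz (derivatives_le (isT : (1 <= 4)%N) sZ.1).
have d2 : 0 < d / 2 by lra.
pose k := C * (r - l) + 1.
have k0 : 0 < k by rewrite ltr_wpDl// mulr_ge0//; lra.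
have dk : 0 < d / 2 / k by rewrite divr_gt0.
have /cvgrPdist_lt /(_ _ dk) Hr := rhoc.
apply: filterS3 Hr rho01 (HZ 0%N isT _ d2) => e He r01 HZe x xA.
have /andP[r0 r1] := r01.
(* Uniform convergence is known at the preimage s of x; as |x - s| <= (1 - rho)(r - l), the
   Lipschitz bound on Z replaces Z(s) by Z(x). *)
pose s := x0 + (x - x0) / rho e.
have xE : x = x0 + rho e * (s - x0).
  by rewrite /s; field; rewrite gt_eqF.
have sl : s \in `[l, r].
  move: xA; rewrite {1}xE !in_itv /= !lerD2l !ler_pM2l// !lerD2r.
  by [].
have h1 := HZe s sl; rewrite /z_ expr0 !mul1r AE -xE in h1.
have h2 := HC x s _ sl; rewrite {1}xE in h2; have {}h2 := h2 (shrink _ _ r01 sl).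
have h3 := ler_wpM2l C0 (near_id _ _ r01 sl); rewrite -xE in h3.
rewrite ger0_norm in He; last by lra.
have -> : D_ e 0%N x - Z 0%N x = (D_ e 0%N x - Z 0%N s) - (Z 0%N x - Z 0%N s) by ring.
apply: le_lt_trans (ler_normB _ _) _.
move: He; rewrite ltr_pdivlMr// /k => He; nra.
Qed.

End outer.

(** * The potential and the resonant problem *)

Section inner.
Context {R : realType}.
Implicit Types (F : set_system R) (D : nat -> R -> R) (l r : R).
Local Notation mu := (@lebesgue_measure R).

Lemma cvg_eq_limits {T : Type} (F : set_system T) (u : T -> R) (c1 c2 : R)
    {FF : ProperFilter F} :
  u e @[e --> F] --> c1 -> u e @[e --> F] --> c2 -> c1 = c2.
Proof. by move=> H1 H2; exact: (cvg_unique _ H1 H2). Qed.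

Lemma unif_cvg_vanish {T : Type} (F : set_system T) l r (u : T -> R)
    (g_ : T -> R -> R) (B : R) {FF : Filter F} :
  u e @[e --> F] --> (0 : R) ->
  (\forall e \near F, forall x, x \in `[l, r] -> `|g_ e x| <= B) ->
  unif_cvg F l r (fun e x => u e * g_ e x) (fun=> 0).
Proof.
move=> uc gB d d0; have B0 : 0 < `|B| + 1 by rewrite ltr_wpDl.
have dB : 0 < d / (`|B| + 1) by rewrite divr_gt0.
move/cvgrPdist_lt : uc => /(_ _ dB) uc.
apply: filterS2 uc gB => e He gB x xl.
rewrite sub0r normrN in He; rewrite subr0 normrM.
have h1 := gB x xl; have h2 := ler_norm B.
move: He; rewrite ltr_pdivlMr//; have := normr_ge0 (u e); have := normr_ge0 (g_ e x).
by move: (`|u e|) (`|g_ e x|) (`|B|) h1 h2 B0 => u1 g1 b1 *; nra.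
Qed.

Lemma C0infty_continuous (f : R -> R) l r : C0infty f ->
  {within `[l, r], continuous f}.
Proof.
move=> [sf _]; apply: derivable_within_continuous => x _.
exact: (sf 0%N x).
Qed.

(** The support condition covers |x| > 1. The case |x| = 1 follows by continuity along the points x
    (1 + t') pushed outwards; it matters because the outer equations are posed on closed intervals
    ending at -eps and eps. *)
Lemma C0infty_out (f : R -> R) x : C0infty f -> 1 <= `|x| -> f x = 0.
Proof.
move=> Cf x1; apply: contrapT => /eqP fx0.
have out y : 1 < `|y| -> f y = 0.
  move=> y1; apply: contrapT => /eqP fy0; case: Cf => _ /(_ y).
  have yc : closure [set x | f x != 0] y by apply: subset_closure.
  by move=> /(_ yc); rewrite /= in_itv /= -ler_norml leNgt y1.
have /within_itv_contP := @C0infty_continuous f (- (`|x| + 1)) (`|x| + 1) Cf.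
have xin : x \in `[- (`|x| + 1), `|x| + 1].
  by rewrite in_itv /= -ler_norml lerDl.
have fp : 0 < `|f x| by rewrite normr_gt0.
move=> /(_ x xin _ fp) [e e0 He].
pose t := Num.min (1 / 2) (e / 2 / `|x|).
have x0 : 0 < `|x| by lra.
have t0 : 0 < t by rewrite lt_min !divr_gt0.
have t1 : t <= e / 2 / `|x| by rewrite ge_min lexx orbT.
rewrite ler_pdivlMr// in t1.
have t2 : t * `|x| <= 1 / 2 * `|x| by rewrite ler_wpM2r// ge_min lexx.
pose t' := Num.min t (1 / `|x|).
have t'0 : 0 < t' by rewrite lt_min t0 divr_gt0.
have t'1 : t' * `|x| <= 1 by rewrite -ler_pdivlMr// ge_min lexx orbT.
have t'2 : t' * `|x| <= t * `|x| by rewrite ler_wpM2r// ge_min lexx.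
have t'3 : 0 < t' * `|x| by rewrite mulr_gt0.
have y'norm : `|x * (1 + t')| = `|x| + t' * `|x|.
  by rewrite normrM [`|1 + t'|]ger0_norm; [ring|lra].
have yin : x * (1 + t') \in `[- (`|x| + 1), `|x| + 1].
  by rewrite in_itv /= -ler_norml y'norm; lra.
have yx : `|x * (1 + t') - x| < e.
  have -> : x * (1 + t') - x = x * t' by ring.
  by rewrite normrM [`|t'|]gtr0_norm// mulrC; lra.
have fy : f (x * (1 + t')) = 0 by apply: out; rewrite y'norm; lra.
by have := He _ yin yx; rewrite fy sub0r normrN ltxx.
Qed.

Lemma C0infty_bounded (f : R -> R) : C0infty f ->
  exists2 M, 0 <= M & forall x, x \in `[-1, 1] -> `|f x| <= M.
Proof. by move=> Cf; apply: within_bounded; exact: C0infty_continuous. Qed.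

Lemma Psi_eps_out (Psi Phi Ups1 Ups2 : R -> R) (alpha beta gamma1 gamma2 e x : R) :
  C0infty Psi -> C0infty Phi -> C0infty Ups1 -> C0infty Ups2 ->
  0 < e -> e <= `|x| ->
  Psi_eps Psi Phi Ups1 Ups2 alpha beta gamma1 gamma2 e x = 0.
Proof.
move=> C1 C2 C3 C4 e0 ex; have xe : 1 <= `|x / e|.
  by rewrite normrM normfV (gtr0_norm e0) ler_pdivlMr// mul1r.
by rewrite /Psi_eps (C0infty_out C1 xe) (C0infty_out C2 xe) (C0infty_out C3 xe)
  (C0infty_out C4 xe) !mulr0 !addr0.
Qed.

(** The factor e^4 is that of the rescaled fourth derivative. The grouping isolates the part of
    order e, whose leading term carries Phi. *)
Lemma Psi_eps_scaled (Psi Phi Ups1 Ups2 : R -> R) (alpha beta gamma1 gamma2 e x : R) :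
  e != 0 ->
  e ^+ 4 * Psi_eps Psi Phi Ups1 Ups2 alpha beta gamma1 gamma2 e (e * x) =
  alpha * Psi x + e * (beta * Phi x + e * (gamma1 * Ups1 x) +
    e ^+ 2 * (gamma2 * Ups2 x)).
Proof.
move=> e0; rewrite /Psi_eps.
have -> : e * x / e = x by rewrite mulrC mulKf.
by field.
Qed.

Lemma resonance_of_solves (Psi : R -> R) (alpha : R) Z :
  solves (-1) 1 (fun x => - alpha * Psi x) Z ->
  Z 2%N (-1) = 0 -> Z 2%N 1 = 0 -> Z 3%N (-1) = 0 -> Z 3%N 1 = 0 ->
  resonance_solution Psi alpha Z.
Proof.
move=> [dZ HZ] *; split => // x xl.
by rewrite HZ; [ring|exact: subset_itv_oo_cc xl].
Qed.

(** Resonance of alpha need not be assumed: a nonzero solution would itself put alpha in [Sigma],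
    and nondegeneracy then contradicts the vanishing derivative at -1. *)
Lemma resonance_trivial (Psi : R -> R) (alpha : R) Z :
  nondegenerate_resonance Psi alpha -> resonance_solution Psi alpha Z ->
  Z 1%N (-1) = 0 -> forall x, x \in `[-1, 1] -> Z 0%N x = 0.
Proof.
move=> nd rZ Z1 x xl; apply: contrapT => /eqP Zx.
have eZ : resonance_eigenfunction Psi alpha Z by split => //; exists x.
have [_ /(_ Z eZ)] := nd (ex_intro _ Z eZ).
by rewrite Z1 mul0r eqxx.
Qed.

Lemma w_eigenfunction (Psi : R -> R) (alpha : R) : Sigma Psi alpha ->
  resonance_eigenfunction Psi alpha (w_ Psi alpha).
Proof.
move=> [W HW].
exact: (@getPex _ [set W | resonance_eigenfunction Psi alpha W] (ex_intro _ W HW)).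
Qed.

(** Simplicity gives proportionality of the functions only; that of the derivatives, up to the
    endpoints, follows because Z - c w vanishes identically. *)
Lemma resonance_solution_multiple (Psi : R -> R) (alpha : R) Z :
  nondegenerate_resonance Psi alpha -> Sigma Psi alpha ->
  resonance_solution Psi alpha Z ->
  exists c : R, forall k x, (k <= 4)%N -> x \in `[-1, 1] ->
    Z k x = c * w_ Psi alpha k x.
Proof.
move=> nd Sa rZ; have [[_ simple] _] := nd Sa.
have ew := w_eigenfunction Sa.
have [c Hc] := simple _ _ ew rZ; exists c => k x k4 xl.
have [[dw _ _ _] _] := ew; have [dZ _ _ _] := rZ.
have lt11 : -1 < 1 :> R by lra.
have d1 := derivatives_lin 1 (- c) dZ dw.
have d2 := derivatives_zero lt11 d1 _ k4 xl.
suff : 1 * Z k x + - c * w_ Psi alpha k x = 0 by lra.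
by apply: d2 => y yl; rewrite Hc//; ring.
Qed.

End inner.

(** * The rescaled problem in the support of the potential *)

Section inner_limit.
Context {R : realType}.
Variables (F : set_system R) (FU : UltraFilter F).
Variables (a b : R) (U Psi Phi Ups1 Ups2 : R -> R).
Variables (alpha beta gamma1 gamma2 MU : R).
Variables (lam : R -> R) (lambda : R) (D_ : R -> nat -> R -> R) (vm vp : nat -> R).
Hypotheses (a_lt0 : a < 0) (b_gt0 : 0 < b).
Hypotheses (CPsi : C0infty Psi) (CPhi : C0infty Phi).
Hypotheses (CUps1 : C0infty Ups1) (CUps2 : C0infty Ups2).
Hypothesis nd : nondegenerate_resonance Psi alpha.
Hypothesis UM : forall x, x \in `[a, b] -> `|U x| <= MU.
Hypothesis lamc : lam e @[e --> F] --> lambda.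
Hypothesis e0 : \forall e \near F, 0 < e.
Hypothesis ec : e @[e --> F] --> (0 : R).
Hypothesis HD : \forall e \near F, solves a b
  (fun x => lam e - U x - Psi_eps Psi Phi Ups1 Ups2 alpha beta gamma1 gamma2 e x)
  (D_ e).
Hypothesis Hvm : forall k, (k < 4)%N -> D_ e k (- e) @[e --> F] --> vm k.
Hypothesis Hvp : forall k, (k < 4)%N -> D_ e k e @[e --> F] --> vp k.
Local Notation mu := (@lebesgue_measure R).

(* z_ e k is the k-th derivative of y_e(e x) / e, and q_ e the coefficient of the
   equation that it solves. *)
Let z_ e k x := e^-1 * e ^+ k * D_ e k (0 + e * x).
(** The deviation of the coefficient from - alpha Psi, divided by e. The limit profile needs only
    that e p_ vanishes; the last interface condition needs the limit - beta Phi of p_ itself. *)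
Let p_ e x := - beta * Phi x + (e ^+ 3 * (lam e - U (e * x)) +
  (e * (- gamma1 * Ups1 x) + e ^+ 2 * (- gamma2 * Ups2 x))).
Let q_ e x := - alpha * Psi x + e * p_ e x.


Let small c : 0 < c -> \forall e \near F, e < c.
Proof.
move=> c0; have /cvgrPdist_lt /(_ _ c0) := ec.
apply: filterS => e; rewrite sub0r normrN => H.
exact: le_lt_trans (ler_norm _) H.
Qed.

Let e_in : \forall e \near F, forall x, x \in `[-1, 1] -> e * x \in `[a, b].
Proof.
have na : 0 < - a by rewrite oppr_gt0.
apply: filterS3 e0 (small na) (small b_gt0) => e ep ea eb x.
by rewrite !in_itv /= => /andP[? ?]; apply/andP; split; nra.
Qed.

Let ek n : e ^+ n.+1 @[e --> F] --> (0 : R).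
Proof.
have H : e ^+ n.+1 @[e --> F] --> (0 : R) ^+ n.+1 by exact: cvg_exprn.
by rewrite expr0n in H.
Qed.

Let cvg_p : unif_cvg F (-1) 1 p_ (fun x => - beta * Phi x).
Proof.
have [M1 M10 HM1] := C0infty_bounded CUps1; have [M2 M20 HM2] := C0infty_bounded CUps2.
have lamB : \forall e \near F, `|lam e| <= `|lambda| + 1.
  move/cvgrPdist_lt : lamc => /(_ _ ltr01); apply: filterS => e He.
  have := lerB_dist (lam e) (lam e - lambda).
  by rewrite subKr distrC; lra.
have H1 : unif_cvg F (-1) 1 (fun e x => e ^+ 3 * (lam e - U (e * x))) (fun=> 0).
  apply: (@unif_cvg_vanish _ _ F (-1) 1 _ _ (`|lambda| + 1 + MU)); first exact: ek.
  apply: filterS2 lamB e_in => e He ein x xl.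
  by apply: le_trans (ler_normB _ _) _; rewrite lerD// UM// ein.
have H2 : unif_cvg F (-1) 1 (fun e x => e * (- gamma1 * Ups1 x)) (fun=> 0).
  apply: (@unif_cvg_vanish _ _ F (-1) 1 _ _ (`|gamma1| * M1)); first exact: ec.
  by apply: nearW => e x xl; rewrite normrM normrN ler_wpM2l// HM1.
have H3 : unif_cvg F (-1) 1 (fun e x => e ^+ 2 * (- gamma2 * Ups2 x)) (fun=> 0).
  apply: (@unif_cvg_vanish _ _ F (-1) 1 _ _ (`|gamma2| * M2)); first exact: ek.
  by apply: nearW => e x xl; rewrite normrM normrN ler_wpM2l// HM2.
have H0 : unif_cvg F (-1) 1 (fun=> fun x => - beta * Phi x) (fun x => - beta * Phi x).
  exact: unif_cvg_cst.
have H : unif_cvg F (-1) 1 p_ (fun x => - beta * Phi x + (0 + (0 + 0))).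
  exact: unif_cvgD H0 (unif_cvgD H1 (unif_cvgD H2 H3)).
move=> d d0; apply: filterS (H d d0) => e He x xl.
by have := He x xl; rewrite !addr0.
Qed.

Let Phi_bound : exists2 M, 0 <= M & forall x, x \in `[-1, 1] -> `|- beta * Phi x| <= M.
Proof.
have [M M0 HM] := C0infty_bounded CPhi; exists (`|beta| * M); first exact: mulr_ge0.
by move=> x xl; rewrite normrM normrN ler_wpM2l// HM.
Qed.

Let cvg_q : unif_cvg F (-1) 1 q_ (fun x => - alpha * Psi x).
Proof.
have [M M0 HM] := Phi_bound.
have H1 : unif_cvg F (-1) 1 (fun e x => e * p_ e x) (fun=> 0).
  apply: (@unif_cvg_vanish _ _ F (-1) 1 _ _ (M + 1)); first exact: ec.
  apply: filterS (cvg_p ltr01) => e He x xl.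
  have -> : p_ e x = - beta * Phi x + (p_ e x - - beta * Phi x) by ring.
  by apply: le_trans (ler_normD _ _) _; rewrite lerD ?HM// ltW// He.
have H0 : unif_cvg F (-1) 1 (fun=> fun x => - alpha * Psi x) (fun x => - alpha * Psi x).
  exact: unif_cvg_cst.
have H : unif_cvg F (-1) 1 q_ (fun x => - alpha * Psi x + 0) by exact: unif_cvgD.
move=> d d0; apply: filterS (H d d0) => e He x xl.
by have := He x xl; rewrite addr0.
Qed.

Let Psi_bound : exists2 M, 0 <= M & forall x, x \in `[-1, 1] -> `|- alpha * Psi x| <= M.
Proof.
have [M M0 HM] := C0infty_bounded CPsi; exists (`|alpha| * M); first exact: mulr_ge0.
by move=> x xl; rewrite normrM normrN ler_wpM2l// HM.
Qed.

Let Hz : \forall e \near F, solves (-1) 1 (q_ e) (z_ e).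
Proof.
apply: filterS3 e0 e_in HD => e ep ein [dD HDe].
have ne0 : e != 0 by rewrite gt_eqF.
have lin : -1 \in `[-1, 1 : R] by rewrite in_itv /=; apply/andP; split; lra.
have rin : 1 \in `[-1, 1 : R] by rewrite in_itv /=; apply/andP; split; lra.
split.
  apply: (derivatives_affine _ ep _ _ dD); rewrite add0r.
    by have := ein _ lin; rewrite in_itv => /andP[].
  by have := ein _ rin; rewrite in_itv => /andP[].
move=> x xl; rewrite /z_ add0r HDe; last exact: ein.
rewrite mulrA -[e^-1 * e ^+ 4 * _]mulrA !mulrBr Psi_eps_scaled// /q_ /p_.
by field.
Qed.

Let z1m : z_ e 1%N (-1) @[e --> F] --> vm 1.
Proof.
apply: near_cvg (Hvm (isT : (1 < 4)%N)); apply: filterS e0 => e ep.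
by rewrite /z_ expr1 mulVf ?gt_eqF// mul1r add0r mulrN1.
Qed.

Let z1p : z_ e 1%N 1 @[e --> F] --> vp 1.
Proof.
apply: near_cvg (Hvp (isT : (1 < 4)%N)); apply: filterS e0 => e ep.
by rewrite /z_ expr1 mulVf ?gt_eqF// mul1r add0r mulr1.
Qed.

(** By scaling, [z_ e k.+2 c] is e^(k+1) times the derivative of y at e c. Hence z'' and z''' tend
    to 0, while after division by e the limit of y'' survives (k = 0) and y''' is still damped (k =
    1); the factor [(k == 0)%:R] records this. *)
Let zhi k c (D := fun e => D_ e k.+2 (e * c)) (v : R) : D e @[e --> F] --> v ->
  z_ e k.+2 c / e @[e --> F] --> v * (k == 0)%:R /\
  z_ e k.+2 c @[e --> F] --> (0 : R).
Proof.
move=> HDv; split.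
  have H : e ^+ k * D e @[e --> F] --> (k == 0)%:R * v.
    apply: cvgM => //; case: k {D HDv} => [|k]; last exact: ek.
    by rewrite eqxx; under eq_cvg do rewrite expr0; exact: cvg_cst.
  rewrite mulrC; apply: near_cvg H; apply: filterS e0 => e ep.
  by rewrite /z_ /D add0r !exprS; field; rewrite gt_eqF.
have H : e ^+ k.+1 * D e @[e --> F] --> 0 * v by exact: cvgM (ek k) HDv.
rewrite mul0r in H; apply: near_cvg H; apply: filterS e0 => e ep.
by rewrite /z_ /D add0r !exprS; field; rewrite gt_eqF.
Qed.

Let zhim k : (k < 2)%N ->
  z_ e k.+2 (-1) / e @[e --> F] --> vm k.+2 * (k == 0)%:R /\
  z_ e k.+2 (-1) @[e --> F] --> (0 : R).
Proof.
move=> k2; apply: zhi; under eq_cvg do rewrite mulrN1.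
exact: Hvm.
Qed.

Let zhip k : (k < 2)%N ->
  z_ e k.+2 1 / e @[e --> F] --> vp k.+2 * (k == 0)%:R /\
  z_ e k.+2 1 @[e --> F] --> (0 : R).
Proof.
move=> k2; apply: zhi; under eq_cvg do rewrite mulr1.
exact: Hvp.
Qed.

Let lin : -1 \in `[-1, 1 : R]. Proof. by rewrite in_itv /=; apply/andP; split; lra. Qed.
Let rin : 1 \in `[-1, 1 : R]. Proof. by rewrite in_itv /=; apply/andP; split; lra. Qed.
Let lt11 : -1 < 1 :> R. Proof. lra. Qed.

Let inner_profile : exists2 W, resonance_solution Psi alpha W &
  forall k, (k <= 4)%N -> unif_cvg F (-1) 1 (fun e => z_ e k) (W k).
Proof.
have [M M0 HM] := Psi_bound.
have [B HB] : exists B, \forall e \near F, forall k, (k < 4)%N -> `|z_ e k (-1)| <= B.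
  apply: (ode_data_bounded lt11 lin HM cvg_q Hz) => s Z s0 sc sZ HZ.
  (* A component of z that converges is sent to 0 by the factor s. This applies to z'' and z''' at
     both ends and to z' at -1. *)
  have lim k x (v : R) : (k <= 4)%N -> x \in `[-1, 1] -> z_ e k x @[e --> F] --> v ->
      Z k x = 0.
    move=> k4 xl Hv.
    have H1 : s e * z_ e k x @[e --> F] --> Z k x by exact: unif_cvg_at (HZ k k4) xl.
    apply: (cvg_eq_limits H1).
    by rewrite -(mul0r v); exact: cvgM.
  apply: (resonance_trivial nd (resonance_of_solves sZ _ _ _ _)).
  - exact: (lim 2%N _ _ isT lin (zhim (isT : (0 < 2)%N)).2).
  - exact: (lim 2%N _ _ isT rin (zhip (isT : (0 < 2)%N)).2).
  - exact: (lim 3%N _ _ isT lin (zhim (isT : (1 < 2)%N)).2).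
  - exact: (lim 3%N _ _ isT rin (zhip (isT : (1 < 2)%N)).2).
  - exact: (lim 1%N _ _ isT lin z1m).
have [W sW HW] := ode_compactness lt11 lin HM cvg_q Hz HB.
exists W => //.
have lim k x : (k <= 4)%N -> x \in `[-1, 1] -> z_ e k x @[e --> F] --> W k x.
  by move=> k4 xl; exact: unif_cvg_at (HW k k4) xl.
apply: (resonance_of_solves sW).
- exact: (cvg_eq_limits (lim 2%N _ isT lin) (zhim (isT : (0 < 2)%N)).2).
- exact: (cvg_eq_limits (lim 2%N _ isT rin) (zhip (isT : (0 < 2)%N)).2).
- exact: (cvg_eq_limits (lim 3%N _ isT lin) (zhim (isT : (1 < 2)%N)).2).
- exact: (cvg_eq_limits (lim 3%N _ isT rin) (zhip (isT : (1 < 2)%N)).2).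
Qed.

Let profile_at W k x :
  (forall k, (k <= 4)%N -> unif_cvg F (-1) 1 (fun e => z_ e k) (W k)) ->
  (k <= 4)%N -> x \in `[-1, 1] -> z_ e k x @[e --> F] --> W k x.
Proof. by move=> HW k4 xl; exact: unif_cvg_at (HW k k4) xl. Qed.

(** y(- e) = e z(-1), and z(-1) converges. *)
Lemma inner_value_left : vm 0%N = 0.
Proof.
have [W _ HW] := inner_profile.
have H : e * z_ e 0%N (-1) @[e --> F] --> 0 * W 0%N (-1).
  by apply: cvgM; [exact: ec|exact: profile_at].
rewrite mul0r in H; apply: (cvg_eq_limits (Hvm (isT : (0 < 4)%N))).
apply: near_cvg H; apply: filterS e0 => e ep.
by rewrite /z_ expr0 mulr1 mulVKf ?gt_eqF// add0r mulrN1.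
Qed.

Lemma inner_value_right : vp 0%N = 0.
Proof.
have [W _ HW] := inner_profile.
have H : e * z_ e 0%N 1 @[e --> F] --> 0 * W 0%N 1.
  by apply: cvgM; [exact: ec|exact: profile_at].
rewrite mul0r in H; apply: (cvg_eq_limits (Hvp (isT : (0 < 4)%N))).
apply: near_cvg H; apply: filterS e0 => e ep.
by rewrite /z_ expr0 mulr1 mulVKf ?gt_eqF// add0r mulr1.
Qed.

(** y(x) = e z(x / e), and z is eventually bounded by M + 1, where M bounds the limit profile. *)
Lemma inner_uniform d : 0 < d ->
  \forall e \near F, forall x, x \in `[- e, e] -> `|D_ e 0%N x| < d.
Proof.
move=> d0; have [W [[cW _] _ _ _] HW] := inner_profile.
have [M M0 HM] := within_bounded (cW 0%N isT).
have d1 : 0 < d / (M + 1) by rewrite divr_gt0//; lra.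
apply: filterS3 e0 (small d1) (HW 0%N isT _ ltr01) => e ep ed He x.
rewrite in_itv /= => /andP[xl xr].
have xi : x / e \in `[-1, 1].
  by rewrite in_itv /= ler_pdivlMr// ler_pdivrMr// mulN1r mul1r xl xr.
have h1 := He _ xi; have h2 := HM _ xi.
have zE : z_ e 0%N (x / e) = D_ e 0%N x / e.
  rewrite /z_ expr0 mulr1 add0r mulrC; congr (D_ e 0%N _ / e).
  by rewrite mulrC divfK// gt_eqF.
have h3 : `|D_ e 0%N x / e| < M + 1.
  rewrite -zE; have -> : z_ e 0%N (x / e) =
    W 0%N (x / e) + (z_ e 0%N (x / e) - W 0%N (x / e)) by ring.
  by apply: le_lt_trans (ler_normD _ _) _; rewrite ler_ltD.
rewrite normrM normfV (gtr0_norm ep) ltr_pdivrMr// in h3.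
apply: lt_trans h3 _; rewrite mulrC -ltr_pdivlMr//; lra.
Qed.

Lemma inner_nonresonant : ~ Sigma Psi alpha -> vm 1%N = 0 /\ vp 1%N = 0.
Proof.
move=> nS; have [W rW HW] := inner_profile.
have W0 x : x \in `[-1, 1] -> W 0%N x = 0.
  move=> xl; apply: contrapT => /eqP Wx; apply: nS; exists W.
  by split => //; exists x.
have [dW _ _ _] := rW.
have Wk := derivatives_zero lt11 dW W0.
split.
  by rewrite (cvg_eq_limits z1m (@profile_at W 1%N (-1) HW isT lin)); exact: Wk.
by rewrite (cvg_eq_limits z1p (@profile_at W 1%N 1 HW isT rin)); exact: Wk.
Qed.

(** With W = c w, the integral side of Lagrange's identity tends to - beta c w'(-1)^2 kappa and the
    boundary side to - w'(1) vp 2 + w'(-1) vm 2. Dividing by - w'(-1) and using vm 1 = c w'(-1)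
    gives the condition on second derivatives. *)
Lemma inner_resonant : Sigma Psi alpha ->
  vp 1%N = theta Psi alpha * vm 1%N /\
  theta Psi alpha * vp 2%N - vm 2%N = beta * kappa Psi Phi alpha * vm 1.
Proof.
move=> Sa; have [W rW HW] := inner_profile.
have [c Hc] := resonance_solution_multiple nd Sa rW.
have ew := w_eigenfunction Sa.
have [_ /(_ _ ew)] := nd Sa.
rewrite mulf_eq0 negb_or => /andP[wm wp].
have [[[cw dw] Hw [w2m w2p] [w3m w3p]] _] := ew.
have [[cW _] _ _ _] := rW.
rewrite /theta /kappa; set w := w_ Psi alpha in Hc wm wp cw dw Hw w2m w2p w3m w3p *.
have vm1 : vm 1%N = c * w 1%N (-1).
  by rewrite (cvg_eq_limits z1m (@profile_at W 1%N (-1) HW isT lin)); exact: Hc.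
have vp1 : vp 1%N = c * w 1%N 1.
  by rewrite (cvg_eq_limits z1p (@profile_at W 1%N 1 HW isT rin)); exact: Hc.
split; first by rewrite vm1 vp1; field.
pose g x := - beta * Phi x * (W 0%N x * w 0%N x).
have cPhi : {within `[-1, 1], continuous Phi} by exact: C0infty_continuous.
have cg : {within `[-1, 1], continuous g}.
  apply: within_mul; last exact: within_mul (cW 0%N isT) (cw 0%N isT).
  by apply: within_mul cPhi; exact: within_cst.
pose A x := \int[mu]_(t in `[-1, x]) g t.
have [cA dA] : {within `[-1, 1], continuous A} /\
    forall x : R, x \in `]-1, 1[ -> is_derive x 1 A (g x) by exact: primitive_within.
have Am : A (-1) = 0 by rewrite /A set_itv1 Rintegral_set1.
pose K := \int[mu]_(xi in `[-1, 1]) (Phi xi * (w 0%N xi / w 1%N (-1)) ^+ 2).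
have A1 : A 1 = - beta * c * w 1%N (-1) ^+ 2 * K.
  rewrite /A /K -RintegralZl//.
    apply: eq_Rintegral => x; rewrite inE => xl.
    by rewrite /g (Hc 0%N x isT xl); field.
  apply: continuous_integrable; apply: (within_mul cPhi).
  by apply: within_exprn2; apply: (within_mul (cw 0%N isT)); exact: within_cst.
(* The boundary term of Lagrange's identity; its derivative is
   e * p_ e * z_ e 0 * w 0, and p_ e -> - beta Phi. *)
pose P e x := z_ e 3%N x * w 0%N x - z_ e 2%N x * w 1%N x +
  z_ e 1%N x * w 2%N x - z_ e 0%N x * w 3%N x.
have [M1 M10 HM1] := within_bounded (cW 0%N isT).
have [M2 M20 HM2] := within_bounded (cw 0%N isT).
have [M3 M30 HM3] := Phi_bound.
have cvg_g : unif_cvg F (-1) 1 (fun e x => p_ e x * (z_ e 0%N x * w 0%N x)) g.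
  have H1 : unif_cvg F (-1) 1 (fun e x => z_ e 0%N x * w 0%N x) (fun x => W 0%N x * w 0%N x).
    by apply: (unif_cvgM HM1 HM2 (HW 0%N isT)); exact: unif_cvg_cst.
  apply: (unif_cvgM HM3 _ cvg_p H1) => x xl.
  by rewrite normrM; apply: ler_pM (HM1 x xl) (HM2 x xl).
(* The derivative of P / e - A is p_ z w - g, uniformly at most d / 2; over an interval of length 2
   the increment is at most d. *)
have H0 : (e^-1 * P e 1 - A 1) - (e^-1 * P e (-1) - A (-1)) @[e --> F] --> (0 : R).
  apply/cvgrPdist_le => d d0; have d2 : 0 < d / 2 by lra.
  apply: filterS3 e0 Hz (cvg_g _ d2) => e ep [[cz dz] Hze] He.
  rewrite sub0r normrN.
  have cP : {within `[-1, 1], continuous P e}.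
    apply: within_sub (within_mul (cz 0%N isT) (cw 3%N isT)).
    apply: within_add (within_mul (cz 1%N isT) (cw 2%N isT)).
    exact: within_sub (within_mul (cz 3%N isT) (cw 0%N isT))
      (within_mul (cz 2%N isT) (cw 1%N isT)).
  have dP (x : R) : x \in `]-1, 1[ ->
      is_derive x 1 (P e) (e * (p_ e x * (z_ e 0%N x * w 0%N x))).
    move=> xl; have m i j (i4 : (i < 4)%N) (j4 : (j < 4)%N) :=
      is_derive_mul (dz i i4 x xl) (dw j j4 x xl).
    apply: (is_derive_eqr (is_derive_sub (is_derive_add (is_derive_sub
      (m 3%N 0%N isT isT) (m 2%N 1%N isT isT)) (m 1%N 2%N isT isT)) (m 0%N 3%N isT isT))).
    have w4 : w 4%N x = - (alpha * Psi x * w 0%N x) by have := Hw x xl; lra.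
    rewrite w4 (Hze x (subset_itv_oo_cc xl)) /q_; ring.
  have := @mvt_lipschitz R (-1) 1 (fun x => e^-1 * P e x - A x)
    (fun x => e^-1 * (e * (p_ e x * (z_ e 0%N x * w 0%N x))) - g x) (d / 2)
    (within_sub (within_mul (@within_cst R (-1) 1 e^-1) cP) cA)
    (fun x xl => is_derive_sub (is_derive_scale _ (dP x xl)) (dA x xl)) _
    1 (-1) rin lin.
  have -> : `|1 - -1 : R| = 2 by rewrite opprK ger0_norm; lra.
  have -> : d / 2 * 2 = d by lra.
  apply => x xl; rewrite mulKf ?gt_eqF//; apply: ltW; apply: He.
  exact: subset_itv_oo_cc xl.
(* The same increment is now evaluated from the boundary values: w'' and w''' vanish at both ends,
   so only z''' / e and z'' / e enter. *)
have H1 : (e^-1 * P e 1 - A 1) - (e^-1 * P e (-1) - A (-1)) @[e --> F] -->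
    (vp 3%N * (1%N == 0%N)%:R * w 0%N 1 - vp 2%N * (0%N == 0%N)%:R * w 1%N 1 - A 1) -
    (vm 3%N * (1%N == 0%N)%:R * w 0%N (-1) -
     vm 2%N * (0%N == 0%N)%:R * w 1%N (-1) - A (-1)).
  have PE e s : s = 1 \/ s = -1 ->
      e^-1 * P e s = z_ e 3%N s / e * w 0%N s - z_ e 2%N s / e * w 1%N s.
    move=> s1; have [E2 E3] : w 2%N s = 0 /\ w 3%N s = 0 by case: s1 => ->.
    by rewrite /P E2 E3; ring.
  suff H2 : (z_ e 3%N 1 / e * w 0%N 1 - z_ e 2%N 1 / e * w 1%N 1 - A 1) -
      (z_ e 3%N (-1) / e * w 0%N (-1) - z_ e 2%N (-1) / e * w 1%N (-1) - A (-1))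
      @[e --> F] -->
      (vp 3%N * (1%N == 0%N)%:R * w 0%N 1 - vp 2%N * (0%N == 0%N)%:R * w 1%N 1 - A 1) -
      (vm 3%N * (1%N == 0%N)%:R * w 0%N (-1) -
     vm 2%N * (0%N == 0%N)%:R * w 1%N (-1) - A (-1)).
    apply: near_cvg H2; apply: nearW => e.
    by rewrite (PE _ 1 (or_introl erefl)) (PE _ (-1) (or_intror erefl)).
  apply: cvgB.
    apply: cvgB; last exact: cvg_cst.
    apply: cvgB; (apply: cvgM; last exact: cvg_cst).
      exact: (zhip (isT : (1 < 2)%N)).1.
    exact: (zhip (isT : (0 < 2)%N)).1.
  apply: cvgB; last exact: cvg_cst.
  apply: cvgB; (apply: cvgM; last exact: cvg_cst).
    exact: (zhim (isT : (1 < 2)%N)).1.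
  exact: (zhim (isT : (0 < 2)%N)).1.
have := @cvg_eq_limits R R F _ _ _ (@ultra_proper _ F FU) H0 H1.
rewrite Am A1 /= !mulr0 !mul0r !mulr1 vm1 => E.
apply: (mulfI wm).
have -> : w 1%N (-1) * (w 1%N 1 / w 1%N (-1) * vp 2%N - vm 2%N) =
  w 1%N 1 * vp 2%N - w 1%N (-1) * vm 2%N by field.
rewrite -/K; lra.
Qed.

End inner_limit.

(** * Limits of real eigenfunctions *)

Section real_limit.
Context {R : realType}.
Implicit Types (F : set_system R) (D : nat -> R -> R) (l r : R).
Local Notation mu := (@lebesgue_measure R).

(** Interface conditions for a single component; the coefficients being real, those for the real and
    imaginary parts combine into the complex ones. *)
Definition real_interface (Psi Phi : R -> R) (alpha beta : R)
    (Dm Dp : nat -> R -> R) :=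
  [/\ Dm 0%N 0 = 0, Dp 0%N 0 = 0,
      ~ Sigma Psi alpha -> Dm 1%N 0 = 0 /\ Dp 1%N 0 = 0 &
      Sigma Psi alpha -> Dp 1%N 0 = theta Psi alpha * Dm 1%N 0 /\
        theta Psi alpha * Dp 2%N 0 - Dm 2%N 0 =
          beta * kappa Psi Phi alpha * Dm 1%N 0].

Lemma integral_sqr_sub_itv l r l' r' (f : R -> R) (c : \bar R) :
  {within `[l, r], continuous f} -> l <= l' -> r' <= r ->
  (\int[mu]_(x in `[l, r]) (f x ^+ 2)%:E <= c)%E ->
  (\int[mu]_(x in `[l', r']) (f x ^+ 2)%:E <= c)%E.
Proof.
move=> cf ll rr; apply: le_trans.
have mf := measurable_int mu (continuous_integrable (within_exprn2 cf)).
have sub : `[l', r'] `<=` `[l, r] by apply: subset_itv; rewrite bnd_simp.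
apply: ge0_subset_integral => //= x _.
rewrite lee_fin.
exact: sqr_ge0.
Qed.

Lemma unif_cvg_sub_scalar (T : Type) (F : set_system T) l r (u : T -> R) (c : R)
    (f : R -> R) {FF : Filter F} : u e @[e --> F] --> c ->
  unif_cvg F l r (fun e x => u e - f x) (fun x => c - f x).
Proof.
move=> /cvgrPdist_lt H d d0; apply: filterS (H d d0) => e He x _.
have -> : u e - f x - (c - f x) = - (c - u e) by ring.
by rewrite normrN.
Qed.

(** The outer intervals end exactly at - e and e, so the one-sided data of [Dm] and [Dp] at 0 are
    the limits that the inner analysis takes as input. Both branches vanish at 0, so the branch
    chosen there is immaterial. *)
Lemma real_limit F (FU : UltraFilter F) (a b : R) (U Psi Phi Ups1 Ups2 : R -> R)
    (alpha beta gamma1 gamma2 : R) (lam : R -> R) (lambda : R)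
    (D_ : R -> nat -> R -> R) :
  a < 0 -> 0 < b -> smooth_on a b U ->
  C0infty Psi -> C0infty Phi -> C0infty Ups1 -> C0infty Ups2 ->
  nondegenerate_resonance Psi alpha ->
  lam e @[e --> F] --> lambda ->
  (\forall e \near F, 0 < e) -> e @[e --> F] --> (0 : R) ->
  (\forall e \near F, solves a b (fun x => lam e - U x -
      Psi_eps Psi Phi Ups1 Ups2 alpha beta gamma1 gamma2 e x) (D_ e)) ->
  (\forall e \near F, [/\ D_ e 0%N a = 0, D_ e 1%N a = 0,
     D_ e 0%N b = 0 & D_ e 1%N b = 0]) ->
  (\forall e \near F, (\int[mu]_(x in `[a, b]) (D_ e 0%N x ^+ 2)%:E <= 1)%E) ->
  exists Dm Dp, [/\ solves a 0 (fun x => lambda - U x) Dm,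
    solves 0 b (fun x => lambda - U x) Dp,
    [/\ Dm 0%N a = 0, Dm 1%N a = 0, Dp 0%N b = 0 & Dp 1%N b = 0],
    real_interface Psi Phi alpha beta Dm Dp &
    forall d, 0 < d -> \forall e \near F, forall x, x \in `[a, b] ->
      `|D_ e 0%N x - (if x <= 0 then Dm 0%N x else Dp 0%N x)| < d].
Proof.
move=> a0 b0 [DU [dDU UE]] C1 C2 C3 C4 nd lamc e0 ec HD Hbc Hint.
have [CU CU0 HCU] := derivative_lipschitz (dDU 1%N).
have [MU MU0 HMU] := within_bounded ((dDU 1%N).1 0%N isT).
have UC x y : x \in `[a, b] -> y \in `[a, b] -> `|U x - U y| <= CU * `|x - y|.
  by move=> xl yl; rewrite !UE// HCU.
have UM x : x \in `[a, b] -> `|U x| <= MU by move=> xl; rewrite UE// HMU.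
have small c : 0 < c -> \forall e \near F, e < c.
  move=> c0; have /cvgrPdist_lt /(_ _ c0) := ec.
  apply: filterS => e; rewrite sub0r normrN => H.
  exact: le_lt_trans (ler_norm _) H.
have outer e l r : 0 < e -> a <= l -> r <= b ->
    solves a b (fun x => lam e - U x -
      Psi_eps Psi Phi Ups1 Ups2 alpha beta gamma1 gamma2 e x) (D_ e) ->
    (forall x, x \in `[l, r] -> e <= `|x|) ->
    solves l r (fun x => lam e - U x) (D_ e).
  move=> ep al rb [dD HDe] ex; split; first exact: derivatives_sub_itv al rb dD.
  move=> x xl; rewrite HDe; last first.
    by move: xl; rewrite !in_itv /= => /andP[? ?]; apply/andP; split; lra.
  by rewrite (Psi_eps_out _ _ _ _ C1 C2 C3 C4 ep (ex x xl)) subr0.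
have qM l r x : a <= l -> r <= b -> x \in `[l, r] -> `|lambda - U x| <= `|lambda| + MU.
  move=> al rb xl; apply: le_trans (ler_normB _ _) _; rewrite lerD2l UM//.
  by move: xl; rewrite !in_itv /= => /andP[? ?]; apply/andP; split; lra.
have sub l r x : a <= l -> r <= b -> x \in `[l, r] -> x \in `[a, b].
  by move=> al rb; rewrite !in_itv /= => /andP[? ?]; apply/andP; split; lra.
have bounded l r x0 c : l < r -> x0 \in `[l, r] -> a <= l -> r <= b -> 0 < c ->
    (forall x, x \in `[l, r] -> c <= `|x|) ->
    exists B, \forall e \near F, forall k, (k < 4)%N -> `|D_ e k x0| <= B.
  move=> lr x0l al rb c0 cx.
  apply: (@l2_data_bounded _ _ F l r x0 D_ (fun e x => lam e - U x)
    (fun x => lambda - U x) (`|lambda| + MU)) => //.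
  - by move=> x xl; exact: qM xl.
  - exact: unif_cvg_sub_scalar.
  - apply: filterS3 e0 (small c c0) HD => e ep ec' HDe.
    apply: outer => // x xl; apply: le_trans (ltW ec') _; exact: cx.
  - apply: filterS2 Hint HD => e Ie [[cD _] _].
    exact: integral_sqr_sub_itv (cD 0%N isT) al rb Ie.
(* The fixed intervals [a, a / 2] and [b / 2, b] are eventually disjoint from the support of the
   potential, so the L_2 norm there bounds the data at a and b. *)
have [Bm HBm] : exists B, \forall e \near F, forall k, (k < 4)%N -> `|D_ e k a| <= B.
  apply: (bounded a (a / 2) a (- a / 2)); try lra.
    by rewrite in_itv /= lexx; lra.
  move=> x; rewrite in_itv /= => /andP[? ?].
  by rewrite ler0_norm; lra.
have [Bp HBp] : exists B, \forall e \near F, forall k, (k < 4)%N -> `|D_ e k b| <= B.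
  apply: (bounded (b / 2) b b (b / 2)); try lra.
    by rewrite in_itv /= lexx andbT; lra.
  move=> x; rewrite in_itv /= => /andP[? ?].
  by rewrite ger0_norm; lra.
(* The ratio 1 + e / a maps [a, 0] onto [a, - e], and 1 + e / (- b) maps [0, b] onto [e, b]; in this
   form both are covered by the case of a negative c. *)
have cvg_rho c : 1 + e / c @[e --> F] --> (1 : R).
  have H : 1 + e / c @[e --> F] --> 1 + 0 / c.
    by apply: cvgD; [exact: cvg_cst|apply: cvgM; [exact: ec|exact: cvg_cst]].
  by rewrite mul0r addr0 in H.
have anz : a != 0 by rewrite lt_eqF.
have bnz : b != 0 by rewrite gt_eqF.
have nb0 : - b < 0 by lra.
have am e : a + (1 + e / a) * (0 - a) = - e by field.
have aa e : a + (1 + e / a) * (a - a) = a by rewrite subrr mulr0 addr0.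
have bm e : b + (1 + e / - b) * (0 - b) = e by field.
have bb e : b + (1 + e / - b) * (b - b) = b by rewrite subrr mulr0 addr0.
have ain : a \in `[a, 0] by rewrite in_itv /= lexx; lra.
have a0in : 0 \in `[a, 0] by rewrite in_itv /= lexx andbT; lra.
have bin : b \in `[0, b] by rewrite in_itv /= lexx andbT; lra.
have b0in : 0 \in `[0, b] by rewrite in_itv /= lexx; lra.
have rho01 c : c < 0 -> \forall e \near F, 0 < 1 + e / c <= 1.
  move=> c0; have nc : 0 < - c by lra.
  apply: filterS2 e0 (small _ nc) => e ep ec'.
  have -> : 1 + e / c = (- c - e) / (- c) by field; lra.
  by rewrite divr_gt0 ?subr_gt0// ler_pdivrMr//; lra.
have a0' : a <= 0 by lra. have b0' : 0 <= b by lra.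
have [||Dm [sDm limDm uDm]] := @outer_limit _ _ F a 0 a (fun e => 1 + e / a) lam lambda U
    CU MU Bm D_ FU a0 ain (fun x xl => UM x (sub _ _ _ (lexx a) b0' xl)) CU0
    (fun x y xl yl => UC x y (sub _ _ _ (lexx a) b0' xl) (sub _ _ _ (lexx a) b0' yl))
    lamc (cvg_rho a) (rho01 a a0).
- apply: filterS3 e0 (small _ b0) HD => e ep eb HDe; rewrite aa am.
  apply: outer => //; first by lra.
  by move=> x; rewrite in_itv /= => /andP[? ?]; rewrite ler0_norm; lra.
- exact: HBm.
have [||Dp [sDp limDp uDp]] := @outer_limit _ _ F 0 b b (fun e => 1 + e / - b) lam lambda U
    CU MU Bp D_ FU b0 bin (fun x xl => UM x (sub _ _ _ a0' (lexx b) xl)) CU0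
    (fun x y xl yl => UC x y (sub _ _ _ a0' (lexx b) xl) (sub _ _ _ a0' (lexx b) yl))
    lamc (cvg_rho (- b)) (rho01 _ nb0).
- have na : 0 < - a by lra.
  apply: filterS3 e0 (small _ na) HD => e ep ea HDe; rewrite bb bm.
  apply: outer => //; first by lra.
  by move=> x; rewrite in_itv /= => /andP[? ?]; rewrite ger0_norm; lra.
- exact: HBp.
have Hvm k : (k < 4)%N -> D_ e k (- e) @[e --> F] --> Dm k 0.
  move=> k4; apply: near_cvg (limDm k (ltnW k4) 0 a0in).
  by apply: nearW => e; rewrite am.
have Hvp k : (k < 4)%N -> D_ e k e @[e --> F] --> Dp k 0.
  move=> k4; apply: near_cvg (limDp k (ltnW k4) 0 b0in).
  by apply: nearW => e; rewrite bm.
have bcm k : (k < 4)%N -> (\forall e \near F, D_ e k a = 0) -> Dm k a = 0.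
  move=> k4 H; apply: (cvg_eq_limits (limDm k (ltnW k4) a ain)).
  have c0 : (fun=> 0) e @[e --> F] --> (0 : R) by exact: cvg_cst.
  by apply: near_cvg c0; apply: filterS H => e; rewrite aa.
have bcp k : (k < 4)%N -> (\forall e \near F, D_ e k b = 0) -> Dp k b = 0.
  move=> k4 H; apply: (cvg_eq_limits (limDp k (ltnW k4) b bin)).
  have c0 : (fun=> 0) e @[e --> F] --> (0 : R) by exact: cvg_cst.
  by apply: near_cvg c0; apply: filterS H => e; rewrite bb.
have vm0 := inner_value_left FU a0 b0 C1 C2 C3 C4 nd UM lamc e0 ec HD Hvm Hvp.
have vp0 := inner_value_right FU a0 b0 C1 C2 C3 C4 nd UM lamc e0 ec HD Hvm Hvp.
exists Dm, Dp; split => //.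
- split.
  + by apply: (bcm 0%N) => //; apply: filterS Hbc => e [].
  + by apply: (bcm 1%N) => //; apply: filterS Hbc => e [].
  + by apply: (bcp 0%N) => //; apply: filterS Hbc => e [].
  + by apply: (bcp 1%N) => //; apply: filterS Hbc => e [].
- split => //.
  + exact: (inner_nonresonant FU a0 b0 C1 C2 C3 C4 nd UM lamc e0 ec HD Hvm Hvp).
  + exact: (inner_resonant FU a0 b0 C1 C2 C3 C4 nd UM lamc e0 ec HD Hvm Hvp).
- move=> d d0; have d2 : 0 < d / 2 by lra.
  have inn := inner_uniform FU a0 b0 C1 C2 C3 C4 nd UM lamc e0 ec HD Hvm Hvp d2.
  have [Cm Cm0 HCm] := derivative_lipschitz (derivatives_le (isT : (1 <= 4)%N) sDm.1).
  have [Cp Cp0 HCp] := derivative_lipschitz (derivatives_le (isT : (1 <= 4)%N) sDp.1).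
  (* On [- e, e] both y and the limit are small: the limit vanishes at 0 and is Lipschitz, hence at
     most (Cm + Cp) e there, below d / 2 for this size of e. *)
  pose k := Cm + Cp + 1; have k0 : 0 < k by rewrite /k; lra.
  have dk : 0 < d / 2 / k by rewrite divr_gt0.
  have Fall : \forall e \near F, [/\ 0 < e, e < d / 2 / k,
      forall x, x \in `[- e, e] -> `|D_ e 0%N x| < d / 2,
      forall x, x \in `[a, - e] -> `|D_ e 0%N x - Dm 0%N x| < d &
      forall x, x \in `[e, b] -> `|D_ e 0%N x - Dp 0%N x| < d].
    near=> e; split.
    + by near: e.
    + by near: e; exact: small.
    + by near: e.
    + by near: e; apply: filterS (uDm d d0) => e; rewrite aa am.
    + by near: e; apply: filterS (uDp d d0) => e; rewrite bb bm.
  apply: filterS Fall => e [ep ek ei em eP] x; rewrite in_itv /= => /andP[ax xb].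
  rewrite ltr_pdivlMr// /k in ek.
  have [x0|x0] := leP x 0.
    have [xe|xe] := leP x (- e); first by apply: em; rewrite in_itv /= ax xe.
    have h1 : `|D_ e 0%N x| < d / 2 by apply: ei; rewrite in_itv /=; apply/andP; split; lra.
    have xin : x \in `[a, 0] by rewrite in_itv /= ax x0.
    have := HCm x 0 xin a0in; rewrite vm0 !subr0 (ler0_norm x0) => h2.
    apply: le_lt_trans (ler_normB _ _) _.
    have h3 : Cm * - x <= Cm * e by apply: ler_wpM2l => //; lra.
    have h4 := mulr_ge0 Cp0 (ltW ep).
    lra.
  have [xe|xe] := leP e x; first by apply: eP; rewrite in_itv /= xe xb.
  have h1 : `|D_ e 0%N x| < d / 2 by apply: ei; rewrite in_itv /=; apply/andP; split; lra.
  have xin : x \in `[0, b] by rewrite in_itv /= xb ltW.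
  have := HCp x 0 xin b0in; rewrite vp0 !subr0 (gtr0_norm x0) => h2.
  apply: le_lt_trans (ler_normB _ _) _.
  have h3 : Cp * x <= Cp * e by apply: ler_wpM2l => //; lra.
  have h4 := mulr_ge0 Cm0 (ltW ep).
  lra.
Unshelve. all: by end_near. Qed.

End real_limit.

(** * Regularity and reality *)

Section regularity.
Context {R : realType}.
Implicit Types (f g : R -> R) (a b l r : R).
Local Notation mu := (@lebesgue_measure R).
Local Open Scope complex_scope.

Lemma within_eq l r f g : (forall x, x \in `[l, r] -> f x = g x) ->
  {within `[l, r], continuous g} -> {within `[l, r], continuous f}.
Proof.
move=> fg /within_itv_contP cg; apply/within_itv_contP => x xl d d0.
have [e e0 He] := cg x xl d d0; exists e => // y yl yx.
by rewrite !fg//; exact: He.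
Qed.

Lemma continuous_measurable_oo l r f : {within `[l, r], continuous f} ->
  measurable_fun `]l, r[ f.
Proof.
move=> cf; have /measurable_EFinP mf := measurable_int mu (continuous_integrable cf).
apply: measurable_funS mf => //.
by apply: subset_itv; rewrite bnd_simp.
Qed.

Lemma Rintegral_cc_oo l r f : measurable_fun `]l, r[ f ->
  \int[mu]_(x in `[l, r]) f x = \int[mu]_(x in `]l, r[) f x.
Proof.
move=> mf; rewrite /Rintegral integral_itv_bndoo//.
exact/measurable_EFinP.
Qed.

Lemma ae_onS l r (P Q : R -> Prop) : (forall x, x \in `]l, r[ -> P x -> Q x) ->
  ae_on l r P -> ae_on l r Q.
Proof.
move=> PQ; rewrite /ae_on; apply: (@filterS _ _ (ae_filter_ringOfSetsType mu)) => x H xl.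
by apply: PQ => //; exact: H.
Qed.

Lemma ae_onS2 l r (P1 P2 Q : R -> Prop) :
  (forall x, x \in `]l, r[ -> P1 x -> P2 x -> Q x) ->
  ae_on l r P1 -> ae_on l r P2 -> ae_on l r Q.
Proof.
move=> PQ; rewrite /ae_on; apply: (@filterS2 _ _ (ae_filter_ringOfSetsType mu)) => x H1 H2 xl.
by apply: PQ => //; [exact: H1|exact: H2].
Qed.

Lemma ae_on_sub l r l' r' (P : R -> Prop) : l <= l' -> r' <= r ->
  ae_on l r P -> ae_on l' r' P.
Proof.
move=> ll rr; rewrite /ae_on; apply: (@filterS _ _ (ae_filter_ringOfSetsType mu)) => x H xl.
apply: H.
by move: xl; rewrite !in_itv /= => /andP[? ?]; apply/andP; split; lra.
Qed.

Lemma Rintegral_ae_eq l r f g : measurable_fun `]l, r[ f ->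
  measurable_fun `]l, r[ g -> ae_on l r (fun x => f x = g x) ->
  \int[mu]_(x in `]l, r[) f x = \int[mu]_(x in `]l, r[) g x.
Proof.
move=> mf mg fg; rewrite /Rintegral; congr fine.
apply: ae_eq_integral => //.
- exact/measurable_EFinP.
- exact/measurable_EFinP.
- move: fg; rewrite /ae_on; apply: (@filterS _ _ (ae_filter_ringOfSetsType mu)).
  by move=> x H xl /=; rewrite H.
Qed.

(** The fourth derivative is given only almost everywhere, but the equation identifies it with a
    continuous g. The third derivative is then a primitive of g, hence of class C^1, and g serves as
    a genuine fourth derivative. *)
Lemma regular_component a b (D : nat -> R -> R) (d4 g : R -> R) : a < b ->
  derivatives_on 3 a b D -> measurable_fun `]a, b[ d4 ->
  ae_on a b (fun x => d4 x = g x) -> {within `[a, b], continuous g} ->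
  (forall x, x \in `[a, b] -> D 3%N x = D 3%N a + \int[mu]_(t in `[a, x]) d4 t) ->
  derivatives_on 4 a b (fun k => if k == 4%N then g else D k).
Proof.
move=> ab [cD dD] md d4g cg HD.
have [cP dP] := primitive_within ab cg.
have D3 x : x \in `[a, b] -> D 3%N x = D 3%N a + \int[mu]_(t in `[a, x]) g t.
  move=> xl; rewrite HD//; congr (_ + _).
  have xb : x <= b by move: xl; rewrite in_itv /= => /andP[].
  have sub : `]a, x[ `<=` `]a, b[ by apply: subset_itv; rewrite bnd_simp.
  have md' : measurable_fun `]a, x[ d4 by apply: measurable_funS md.
  have mg' : measurable_fun `]a, x[ g.
    by apply: measurable_funS (continuous_measurable_oo cg).
  rewrite !Rintegral_cc_oo//; apply: Rintegral_ae_eq => //.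
  exact: ae_on_sub d4g.
split=> k k4.
  have [_|k4'] := eqVneq k 4%N; first exact: cg.
  by apply: cD; rewrite -ltnS ltn_neqAle k4' k4.
move=> x xl; rewrite (ltn_eqF k4) eqSS.
have [->|k3] := eqVneq k 3%N; last by apply: dD xl; rewrite ltn_neqAle k3 -ltnS.
apply: (@near_eq_is_derive R _ _ (fun x => D 3%N a + \int[mu]_(t in `[a, x]) g t)).
  near=> z; apply: esym; apply: D3; apply: subset_itv_oo_cc; near: z.
  exact: near_in_itvoo.
have := is_derive_add (is_derive_cst (D 3%N a) x 1) (dP x xl).
by rewrite add0r.
Unshelve. all: by end_near. Qed.

Lemma smooth_within (f : R -> R) (c : R) l r : smooth f ->
  {within `[l, r], continuous (fun x => f (x / c))}.
Proof.
move=> sf; apply: continuous_subspaceT => x.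
have cfx (y : R) : {for y, continuous f}.
  by apply/differentiable_continuous; rewrite -derivable1_diffP; exact: (sf 0%N).
apply: (@continuous_comp _ _ _ (fun x : R => x / c) f); last exact: cfx.
by apply: cvgM; [exact: cvg_id|exact: cvg_cst].
Qed.

Lemma Psi_eps_within (Psi Phi Ups1 Ups2 : R -> R) (alpha beta gamma1 gamma2 e l r : R) :
  C0infty Psi -> C0infty Phi -> C0infty Ups1 -> C0infty Ups2 ->
  {within `[l, r], continuous (Psi_eps Psi Phi Ups1 Ups2 alpha beta gamma1 gamma2 e)}.
Proof.
move=> [C1 _] [C2 _] [C3 _] [C4 _].
have term (c : R) f : smooth f -> {within `[l, r], continuous (fun x => c * f (x / e))}.
  by move=> sf; apply: within_mul; [exact: within_cst|exact: smooth_within].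
exact: (within_add (within_add (within_add (term _ _ C1) (term _ _ C2)) (term _ _ C3))
  (term _ _ C4)).
Qed.

Lemma smooth_on_within l r (f : R -> R) : smooth_on l r f ->
  {within `[l, r], continuous f}.
Proof.
move=> [D [dD fD]]; apply: (within_eq fD).
exact: ((dD 0%N).1 0%N isT).
Qed.

Lemma complex_ReM (z w : R[i]) : complex.Re (z * w) =
  complex.Re z * complex.Re w - complex.Im z * complex.Im w.
Proof. by case: z w => [? ?] []. Qed.

Lemma complex_ImM (z w : R[i]) : complex.Im (z * w) =
  complex.Re z * complex.Im w + complex.Im z * complex.Re w.
Proof. by case: z w => [? ?] []. Qed.

Lemma complex_ReD (z w : R[i]) : complex.Re (z + w) = complex.Re z + complex.Re w.
Proof. by case: z w => [? ?] []. Qed.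

Lemma complex_ImD (z w : R[i]) : complex.Im (z + w) = complex.Im z + complex.Im w.
Proof. by case: z w => [? ?] []. Qed.

Lemma complex_ext (z w : R[i]) : complex.Re z = complex.Re w ->
  complex.Im z = complex.Im w -> z = w.
Proof. by case: z w => [? ?] [? ?] /= -> ->. Qed.

(** The real and imaginary parts are coupled through Im lam until the eigenvalue is known to be
    real. The equations hold at every x because the fourth derivatives are defined by these
    formulas. *)
Lemma eigenfunction_regular a b (U Psi Phi Ups1 Ups2 : R -> R)
    (alpha beta gamma1 gamma2 e : R) (lam : R[i]) (y : R -> R[i])
    (P := Psi_eps Psi Phi Ups1 Ups2 alpha beta gamma1 gamma2 e) :
  a < b -> smooth_on a b U ->
  C0infty Psi -> C0infty Phi -> C0infty Ups1 -> C0infty Ups2 ->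
  S_eps a b U Psi Phi Ups1 Ups2 alpha beta gamma1 gamma2 e y (fun x => lam * y x) ->
  exists Dr Di : nat -> R -> R, [/\
    derivatives_on 4 a b Dr /\ derivatives_on 4 a b Di,
    ae_on a b (fun x => y x = Dr 0%N x +i* Di 0%N x),
    [/\ Dr 0%N a = 0, Dr 1%N a = 0, Dr 0%N b = 0 & Dr 1%N b = 0],
    [/\ Di 0%N a = 0, Di 1%N a = 0, Di 0%N b = 0 & Di 1%N b = 0] &
    forall x,
     Dr 4%N x = (complex.Re lam - U x - P x) * Dr 0%N x - complex.Im lam * Di 0%N x /\
     Di 4%N x = (complex.Re lam - U x - P x) * Di 0%N x + complex.Im lam * Dr 0%N x].
Proof.
move=> ab sU C1 C2 C3 C4 [D [[dr di [mr mi _] D3] yD [D0a D1a] [D0b D1b] Heq]].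
have cU := smooth_on_within sU.
have cP : {within `[a, b], continuous P} by exact: Psi_eps_within.
pose q x := complex.Re lam - U x - P x.
have cq : {within `[a, b], continuous q}.
  by apply: within_sub cP; apply: within_sub cU; exact: within_cst.
pose gr x := q x * complex.Re (D 0%N x) - complex.Im lam * complex.Im (D 0%N x).
pose gi x := q x * complex.Im (D 0%N x) + complex.Im lam * complex.Re (D 0%N x).
have c0r := dr.1 0%N isT; have c0i := di.1 0%N isT.
have cst : {within `[a, b], continuous (fun=> complex.Im lam)} by exact: within_cst.
have cgr : {within `[a, b], continuous gr}.
  exact: within_sub (within_mul cq c0r) (within_mul cst c0i).
have cgi : {within `[a, b], continuous gi}.
  exact: within_add (within_mul cq c0i) (within_mul cst c0r).
have D4 : ae_on a b (fun x => complex.Re (D 4%N x) = gr x /\ complex.Im (D 4%N x) = gi x).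
  apply: (ae_onS2 _ yD Heq) => x _ ->; rewrite -/(P x).
  move=> E; have := congr1 (@complex.Re R) E; have := congr1 (@complex.Im R) E.
  by rewrite /gr /gi /q !(complex_ReD, complex_ImD, complex_ReM, complex_ImM) /=; split; lra.
exists (fun k => if k == 4%N then gr else fun x => complex.Re (D k x)).
exists (fun k => if k == 4%N then gi else fun x => complex.Im (D k x)).
split => //.
- split.
    apply: (regular_component ab dr mr _ cgr).
      by apply: ae_onS D4 => x _ [].
    by move=> x xl; rewrite D3// complex_ReD.
  apply: (regular_component ab di mi _ cgi).
    by apply: ae_onS D4 => x _ [].
  by move=> x xl; rewrite D3// complex_ImD.
- by apply: ae_onS yD => x _ -> /=; case: (D 0%N x).
- by rewrite /= D0a D1a D0b D1b.
- by rewrite /= D0a D1a D0b D1b.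
Qed.

(** Symmetry of the operator in real terms: the clamped ends make Lagrange's bracket vanish at a and
    b, so nu times the squared norm is 0. *)
Lemma eigenvalue_real a b (q : R -> R) (nu : R) (Dr Di : nat -> R -> R) : a < b ->
  derivatives_on 4 a b Dr -> derivatives_on 4 a b Di ->
  [/\ Dr 0%N a = 0, Dr 1%N a = 0, Dr 0%N b = 0 & Dr 1%N b = 0] ->
  [/\ Di 0%N a = 0, Di 1%N a = 0, Di 0%N b = 0 & Di 1%N b = 0] ->
  (forall x, Dr 4%N x = q x * Dr 0%N x - nu * Di 0%N x /\
     Di 4%N x = q x * Di 0%N x + nu * Dr 0%N x) ->
  \int[mu]_(x in `[a, b]) (Dr 0%N x ^+ 2 + Di 0%N x ^+ 2) = 1 -> nu = 0.
Proof.
move=> ab [cr dr] [ci di] [ra0 ra1 rb0 rb1] [ia0 ia1 ib0 ib1] H4 norm1.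
(* Lagrange's identity between the real and imaginary parts: L' = - nu |y|^2. *)
pose L x := Dr 3%N x * Di 0%N x - Dr 2%N x * Di 1%N x + Dr 1%N x * Di 2%N x -
  Dr 0%N x * Di 3%N x.
pose g x := - nu * (Dr 0%N x ^+ 2 + Di 0%N x ^+ 2).
have cs : {within `[a, b], continuous (fun x => Dr 0%N x ^+ 2 + Di 0%N x ^+ 2)}.
  exact: within_add (within_exprn2 (cr 0%N isT)) (within_exprn2 (ci 0%N isT)).
have cg : {within `[a, b], continuous g} by apply: within_mul cs; exact: within_cst.
have cL : {within `[a, b], continuous L}.
  exact: within_sub (within_add (within_sub
    (within_mul (cr 3%N isT) (ci 0%N isT)) (within_mul (cr 2%N isT) (ci 1%N isT)))
    (within_mul (cr 1%N isT) (ci 2%N isT))) (within_mul (cr 0%N isT) (ci 3%N isT)).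
have dL (x : R) : x \in `]a, b[ -> is_derive x 1 L (g x).
  move=> xl; have m i j (i4 : (i < 4)%N) (j4 : (j < 4)%N) :=
    is_derive_mul (dr i i4 x xl) (di j j4 x xl).
  apply: (is_derive_eqr (is_derive_sub (is_derive_add (is_derive_sub
    (m 3%N 0%N isT isT) (m 2%N 1%N isT isT)) (m 1%N 2%N isT isT)) (m 0%N 3%N isT isT))).
  by rewrite (H4 x).1 (H4 x).2 /g; ring.
have bin : b \in `[a, b] by rewrite in_itv /= lexx andbT ltW.
have := Rintegral_derivative ab cg cL dL bin.
rewrite {1 2}/L ra0 ra1 rb0 rb1 ia0 ia1 ib0 ib1 /g.
have -> : \int[mu]_(t in `[a, b]) (- nu * (Dr 0%N t ^+ 2 + Di 0%N t ^+ 2)) = - nu * 1.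
  by rewrite -norm1 RintegralZl//; exact: continuous_integrable cs.
lra.
Qed.

End regularity.

(** * Weak limits *)

Section weak_limits.
Context {R : realType}.
Implicit Types (f g : R -> R) (a b l r : R).
Local Notation mu := (@lebesgue_measure R).

Let integrable_oo l r f := mu.-integrable `]l, r[ (EFin \o f).

Lemma continuous_integrable_oo l r f : {within `[l, r], continuous f} ->
  integrable_oo l r f.
Proof.
move=> cf; apply: integrableS (continuous_integrable cf) => //.
by apply: subset_itv; rewrite bnd_simp.
Qed.

Lemma integrable_add l r f g : integrable_oo l r f -> integrable_oo l r g ->
  integrable_oo l r (fun x => f x + g x).
Proof. by move=> hf hg; exact: (integrableD _ hf hg). Qed.

Lemma integrable_scale l r (c : R) f : integrable_oo l r f ->
  integrable_oo l r (fun x => c * f x).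
Proof. by move=> hf; exact: (integrableZl _ c hf). Qed.

Lemma integrable_le l r f g : measurable_fun `]l, r[ f -> integrable_oo l r g ->
  (forall x, x \in `]l, r[ -> `|f x| <= `|g x|) -> integrable_oo l r f.
Proof.
move=> mf ig fg; apply: le_integrable ig => //; first exact/measurable_EFinP.
Qed.

Lemma integrable_mul_continuous l r f g : {within `[l, r], continuous f} ->
  integrable_oo l r g -> integrable_oo l r (fun x => f x * g x).
Proof.
move=> cf ig; have [M M0 HM] := within_bounded cf.
have mg : measurable_fun `]l, r[ g.
  by apply/measurable_EFinP; exact: measurable_int ig.
apply: (integrable_le _ (integrable_scale M ig)).
  by apply: measurable_funM => //; exact: continuous_measurable_oo.
move=> x xl; rewrite !normrM ler_wpM2r// (le_trans (HM x _))// ?ler_norm//.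
exact: subset_itv_oo_cc xl.
Qed.

(** On a bounded interval L_2 lies in L_1, by |s| <= 1 + s^2 + t^2. *)
Lemma sqr_integrable l r f g : measurable_fun `]l, r[ f -> measurable_fun `]l, r[ g ->
  (\int[mu]_(x in `]l, r[) (f x ^+ 2 + g x ^+ 2)%:E < +oo)%E ->
  [/\ integrable_oo l r f, integrable_oo l r g &
      integrable_oo l r (fun x => f x ^+ 2 + g x ^+ 2)].
Proof.
move=> mf mg fin.
have m2 : measurable_fun `]l, r[ (fun x => f x ^+ 2 + g x ^+ 2).
  by apply: measurable_funD; exact: measurable_funX.
have i2 : integrable_oo l r (fun x => f x ^+ 2 + g x ^+ 2).
  apply/integrableP; split; first exact/measurable_EFinP.
  under eq_integral do rewrite /= ger0_norm ?addr_ge0 ?sqr_ge0//.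
  exact: fin.
have i1 : integrable_oo l r (fun x => 1 + (f x ^+ 2 + g x ^+ 2)).
  by apply: integrable_add i2; apply: continuous_integrable_oo; exact: within_cst.
have le1 (s t : R) : `|s| <= 1 + (s ^+ 2 + t ^+ 2).
  have := sqr_ge0 t; have := sqr_ge0 (s - 1); have := sqr_ge0 (s + 1).
  have := sqr_ge0 s.
  by rewrite ler_norml => *; apply/andP; split; lra.
split => //; apply: (integrable_le _ i1) => // x _.
  by rewrite [leRHS]ger0_norm ?le1// !addr_ge0// sqr_ge0.
by rewrite [leRHS]ger0_norm 1?[f x ^+ 2 + _]addrC ?le1// !addr_ge0// sqr_ge0.
Qed.

(** The test function is v - V itself, admissible since V is continuous on a compact interval. Pairs
    of real functions suffice because only the real part of the inner product is used. *)
Lemma weak_limit_unique (F : set_system R) a b (y1 y2 r_ s_ : R -> R -> R)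
    (v1 v2 V1 V2 : R -> R) {FF : ProperFilter F} : a < b ->
  measurable_fun `]a, b[ v1 -> measurable_fun `]a, b[ v2 ->
  (\int[mu]_(x in `]a, b[) (v1 x ^+ 2 + v2 x ^+ 2)%:E < +oo)%E ->
  {within `[a, b], continuous V1} -> {within `[a, b], continuous V2} ->
  (\forall e \near F, [/\ measurable_fun `]a, b[ (y1 e),
     measurable_fun `]a, b[ (y2 e),
     {within `[a, b], continuous (r_ e)}, {within `[a, b], continuous (s_ e)} &
     ae_on a b (fun x => y1 e x = r_ e x /\ y2 e x = s_ e x)]) ->
  unif_cvg F a b r_ V1 -> unif_cvg F a b s_ V2 ->
  (forall h1 h2 : R -> R, measurable_fun `]a, b[ h1 -> measurable_fun `]a, b[ h2 ->
    (\int[mu]_(x in `]a, b[) (h1 x ^+ 2 + h2 x ^+ 2)%:E < +oo)%E ->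
    \int[mu]_(x in `]a, b[) (y1 e x * h1 x + y2 e x * h2 x) @[e --> F] -->
    \int[mu]_(x in `]a, b[) (v1 x * h1 x + v2 x * h2 x)) ->
  ae_on a b (fun x => v1 x = V1 x /\ v2 x = V2 x).
Proof.
move=> ab mv1 mv2 vfin cV1 cV2 near_y ur us weak.
have [iv1 iv2 ivv] := sqr_integrable mv1 mv2 vfin.
have mV1 := continuous_measurable_oo cV1; have mV2 := continuous_measurable_oo cV2.
pose h1 x := v1 x - V1 x; pose h2 x := v2 x - V2 x.
have mh1 : measurable_fun `]a, b[ h1 by exact: measurable_funB.
have mh2 : measurable_fun `]a, b[ h2 by exact: measurable_funB.
have mhh : measurable_fun `]a, b[ (fun x => h1 x ^+ 2 + h2 x ^+ 2).
  by apply: measurable_funD; exact: measurable_funX.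
have ihh : integrable_oo a b (fun x => h1 x ^+ 2 + h2 x ^+ 2).
  have iVV : integrable_oo a b (fun x => V1 x ^+ 2 + V2 x ^+ 2).
    apply: continuous_integrable_oo.
    exact: within_add (within_exprn2 cV1) (within_exprn2 cV2).
  apply: (integrable_le mhh (integrable_add (integrable_scale 2 ivv)
    (integrable_scale 2 iVV))) => x _.
  rewrite ger0_norm ?addr_ge0 ?sqr_ge0// ger0_norm; last first.
    by rewrite addr_ge0// mulr_ge0// addr_ge0// sqr_ge0.
  rewrite /h1 /h2.
  have := sqr_ge0 (v1 x + V1 x); have := sqr_ge0 (v2 x + V2 x); lra.
have hfin : (\int[mu]_(x in `]a, b[) (h1 x ^+ 2 + h2 x ^+ 2)%:E < +oo)%E.
  have /integrableP[_] := ihh; apply: le_lt_trans; apply: ge0_le_integral => //.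
  - by move=> x _; rewrite lee_fin; apply: addr_ge0; exact: sqr_ge0.
  - exact/measurable_EFinP.
  - by apply: measurableT_comp => //; exact/measurable_EFinP.
  - by move=> x _; rewrite lee_fin; exact: ler_norm.
have [ih1 ih2 _] := sqr_integrable mh1 mh2 hfin.
have lim1 := weak h1 h2 mh1 mh2 hfin.
pose K := \int[mu]_(x in `]a, b[) (`|h1 x| + `|h2 x|).
have iK : integrable_oo a b (fun x => `|h1 x| + `|h2 x|).
  by apply: integrable_add; exact: integrable_norm.
have K0 : 0 <= K by apply: Rintegral_ge0 => x _; exact: addr_ge0.
have iV : integrable_oo a b (fun x => V1 x * h1 x + V2 x * h2 x).
  by apply: integrable_add; exact: integrable_mul_continuous.
have lim2 : \int[mu]_(x in `]a, b[) (y1 e x * h1 x + y2 e x * h2 x) @[e --> F] -->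
    \int[mu]_(x in `]a, b[) (V1 x * h1 x + V2 x * h2 x).
  apply/cvgrPdist_le => d d0.
  have K1 : 0 < K + 1 by lra.
  have dK : 0 < d / (K + 1) by rewrite divr_gt0.
  apply: filterS3 near_y (ur _ dK) (us _ dK) => e [m1 m2 cr cs ae_y] Hr Hs.
  have ir : integrable_oo a b (fun x => r_ e x * h1 x + s_ e x * h2 x).
    by apply: integrable_add; exact: integrable_mul_continuous.
  have -> : \int[mu]_(x in `]a, b[) (y1 e x * h1 x + y2 e x * h2 x) =
      \int[mu]_(x in `]a, b[) (r_ e x * h1 x + s_ e x * h2 x).
    apply: Rintegral_ae_eq.
    - by apply: measurable_funD; exact: measurable_funM.
    - by apply/measurable_EFinP; exact: measurable_int ir.
    - by apply: ae_onS ae_y => x _ [-> ->].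
  rewrite -RintegralB//.
  have im : integrable_oo a b (fun x => V1 x * h1 x + V2 x * h2 x -
      (r_ e x * h1 x + s_ e x * h2 x)).
    apply: integrable_add iV _; have := integrable_scale (-1) ir.
    by under eq_fun do rewrite mulN1r.
  apply: (le_trans (le_normr_Rintegral _ im)) => //.
  have iDK := integrable_scale (d / (K + 1)) iK.
  apply: (@le_trans _ _ (\int[mu]_(x in `]a, b[) (d / (K + 1) * (`|h1 x| + `|h2 x|)))).
    apply: le_Rintegral => //; first exact: integrable_norm.
    move=> x xl; have xc := subset_itv_oo_cc xl.
    have -> : V1 x * h1 x + V2 x * h2 x - (r_ e x * h1 x + s_ e x * h2 x) =
      - ((r_ e x - V1 x) * h1 x + (s_ e x - V2 x) * h2 x) by ring.
    rewrite normrN [leRHS]mulrDr; apply: le_trans (ler_normD _ _) _.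
    rewrite !normrM; apply: lerD; apply: ler_wpM2r => //; apply: ltW.
      exact: Hr.
    exact: Hs.
  rewrite RintegralZl// -/K mulrAC ler_pdivrMr//.
  by apply: ler_wpM2l; [exact: ltW|lra].
(* Both limits agree, so v - V is orthogonal to itself. *)
have int_eq : \int[mu]_(x in `]a, b[) (v1 x * h1 x + v2 x * h2 x) =
  \int[mu]_(x in `]a, b[) (V1 x * h1 x + V2 x * h2 x) by exact: cvg_eq_limits lim1 lim2.
have int0 : \int[mu]_(x in `]a, b[) (h1 x ^+ 2 + h2 x ^+ 2) = 0.
  have E : \int[mu]_(x in `]a, b[) (v1 x * h1 x + v2 x * h2 x) =
      \int[mu]_(x in `]a, b[) ((h1 x ^+ 2 + h2 x ^+ 2) + (V1 x * h1 x + V2 x * h2 x)).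
    by apply: eq_Rintegral => x _; rewrite /h1 /h2; ring.
  rewrite int_eq [RHS]RintegralD// in E; move/eqP: E.
  by rewrite -subr_eq subrr => /eqP <-.
have := ae_eq_integral_abs mu (measurable_itv `]a, b[)
  (f := EFin \o (fun x => h1 x ^+ 2 + h2 x ^+ 2)).
move=> /(_ _)[|+ _]; first exact/measurable_EFinP.
under eq_integral do rewrite /= ger0_norm ?addr_ge0 ?sqr_ge0//.
have fnum : (\int[mu]_(x in `]a, b[) (h1 x ^+ 2 + h2 x ^+ 2)%:E)%E \is a fin_num.
  exact: integrable_fin_num ihh.
move=> /(_ _); rewrite -(fineK fnum) => /(_ (congr1 _ int0)).
apply: (@filterS _ _ (ae_filter_ringOfSetsType mu)) => x H xl.
have [E] := H xl.
have h1s := sqr_ge0 (h1 x); have h2s := sqr_ge0 (h2 x).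
have /eqP : h1 x ^+ 2 = 0 by lra.
have /eqP : h2 x ^+ 2 = 0 by lra.
rewrite !sqrf_eq0 /h1 /h2 !subr_eq0 => /eqP -> /eqP ->.
by [].
Qed.

(** If some neighbourhood V of c failed, F restricted to the complement of the preimage of V would
    be proper, and an ultrafilter above it would contradict the hypothesis. *)
Lemma cvg_ultra (F : set_system R) (u : R -> R) (c : R) {FF : ProperFilter F} :
  (forall G, UltraFilter G -> F `<=` G -> u e @[e --> G] --> c) ->
  u e @[e --> F] --> c.
Proof.
move=> H V nV; apply: contrapT => nF.
pose A := ~` (u @^-1` V).
have properA : ProperFilter (within A F).
  split; last exact: within_filter.
  rewrite /within /= => H0; apply: nF; apply: filterS H0 => x nA.
  by apply: contrapT => nV'; exact: nA.
have [G [UG sG]] := ultraFilterLemma properA.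
have FG : F `<=` G.
  by move=> B FB; apply: sG; apply: filterS FB => x Bx _.
have GV : G (u @^-1` V) by exact: (H G UG FG V nV).
have GA : G A by apply: sG; rewrite /within /=; apply: filterE => x.
by have [x [? ?]] := filter_ex (filterI GV GA).
Qed.

End weak_limits.

(** * Complex-valued functions *)

Section complex_functions.
Context {R : realType}.
Implicit Types (l r : R) (f g : R -> R[i]).
Local Notation mu := (@lebesgue_measure R).
Local Open Scope complex_scope.

Lemma complex_ReN (z : R[i]) : complex.Re (- z) = - complex.Re z.
Proof. by case: z. Qed.

Lemma complex_ImN (z : R[i]) : complex.Im (- z) = - complex.Im z.
Proof. by case: z. Qed.

Definition complex_ReImE := (@complex_ReD R, complex_ReN, @complex_ReM R,
  @complex_ImD R, complex_ImN, @complex_ImM R).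

Lemma Re_L2inner l r f g : complex.Re (L2inner l r f g) =
  \int[mu]_(x in `]l, r[) (complex.Re (f x) * complex.Re (g x) +
                           complex.Im (f x) * complex.Im (g x)).
Proof.
rewrite /L2inner /=; apply: eq_Rintegral => x _.
by rewrite complex_ReM; case: (g x) => g1 g2 /=; rewrite mulrN opprK.
Qed.

Lemma L2normE l r f : L2norm l r f = Num.sqrt
  (\int[mu]_(x in `]l, r[) (complex.Re (f x) ^+ 2 + complex.Im (f x) ^+ 2)).
Proof. by rewrite /L2norm Re_L2inner. Qed.

Lemma cvgC_Re_Im (F : set_system R) (u : R -> R[i]) (z : R[i]) {FF : Filter F} :
  cvgC F u z -> complex.Re (u e) @[e --> F] --> complex.Re z /\
                complex.Im (u e) @[e --> F] --> complex.Im z.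
Proof.
move=> /cvgrPdist_lt H; split; apply/cvgrPdist_lt => d d0; apply: filterS (H d d0) => e.
  rewrite sub0r normrN; apply: le_lt_trans; rewrite -normrN opprB.
  have -> : complex.Re (u e) - complex.Re z = complex.Re (u e - z).
    by rewrite complex_ReD complex_ReN.
  case: (u e - z) => p q /=; rewrite [leRHS]ger0_norm ?sqrtr_ge0//.
  by rewrite -sqrtr_sqr ler_wsqrtr// lerDl sqr_ge0.
rewrite sub0r normrN; apply: le_lt_trans; rewrite -normrN opprB.
have -> : complex.Im (u e) - complex.Im z = complex.Im (u e - z).
  by rewrite complex_ImD complex_ImN.
case: (u e - z) => p q /=; rewrite [leRHS]ger0_norm ?sqrtr_ge0//.
by rewrite -sqrtr_sqr ler_wsqrtr// lerDr sqr_ge0.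
Qed.

Lemma W24_of_derivatives l r (Dr Di : nat -> R -> R) : l < r ->
  derivatives_on 4 l r Dr -> derivatives_on 4 l r Di ->
  W24 l r (fun k x => Dr k x +i* Di k x).
Proof.
move=> lr dr di; split.
- exact: derivatives_le dr.
- exact: derivatives_le di.
- have c4r := dr.1 4%N isT; have c4i := di.1 4%N isT.
  split; [exact: continuous_measurable_oo|exact: continuous_measurable_oo|].
  have H := continuous_integrable_oo (within_add (within_exprn2 c4r) (within_exprn2 c4i)).
  by rewrite ltey_eq (integrable_fin_num _ H).
- move=> x xl; have [cr der] := dr; have [ci dei] := di.
  by apply: complex_ext; rewrite ?complex_ReD ?complex_ImD /=;
    [apply: (Rintegral_derivative lr (cr 4%N isT) (cr 3%N isT) (der 3%N isT))
    |apply: (Rintegral_derivative lr (ci 4%N isT) (ci 3%N isT) (dei 3%N isT))].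
Qed.

Lemma complex_interface (Psi Phi : R -> R) (alpha beta : R)
    (Dmr Dmi Dpr Dpi : nat -> R -> R) :
  real_interface Psi Phi alpha beta Dmr Dpr ->
  real_interface Psi Phi alpha beta Dmi Dpi ->
  interface_conditions Psi Phi alpha beta (fun k x => Dmr k x +i* Dmi k x)
    (fun k x => Dpr k x +i* Dpi k x).
Proof.
move=> [r1 r2 r3 r4] [i1 i2 i3 i4]; split.
  move=> nS; have [r5 r6] := r3 nS; have [i5 i6] := i3 nS.
  by rewrite r1 r2 r5 r6 i1 i2 i5 i6.
move=> S; have [r5 r6] := r4 S; have [i5 i6] := i4 S.
split; [by rewrite r1 i1|by rewrite r2 i2| |].
  by apply: complex_ext; rewrite !complex_ReImE /= ?r5 ?i5; ring.
by apply: complex_ext; rewrite !complex_ReImE /=; [move: r6|move: i6]; lra.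
Qed.

Lemma Rintegral_le_cst (l r : R) (f : R -> R) (c : R) : l < r ->
  {within `[l, r], continuous f} -> (forall x, x \in `[l, r] -> `|f x| <= c) ->
  `|\int[mu]_(x in `[l, r]) f x| <= c * (r - l).
Proof.
move=> lr cf fc; have [cP dP] := primitive_within lr cf.
have lin : l \in `[l, r] by rewrite in_itv /= lexx ltW.
have rin : r \in `[l, r] by rewrite in_itv /= lexx andbT ltW.
have := mvt_lipschitz cP dP (fun x xl => fc x (subset_itv_oo_cc xl)) rin lin.
by rewrite set_itv1 Rintegral_set1 subr0 [`|r - l|]gtr0_norm// subr_gt0.
Qed.

End complex_functions.

(** * The limit eigenpair *)

Section limit.
Context {R : realType}.
Local Notation mu := (@lebesgue_measure R).
Local Open Scope complex_scope.

(** Both components come as one pair so that a single choice over eps provides them. Each has L_2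
    norm at most 1 because their squared norms add up to 1. *)
Lemma eigenfunction_components (a b : R) (U Psi Phi Ups1 Ups2 : R -> R)
    (alpha beta gamma1 gamma2 e : R) (lam : R[i]) (y : R -> R[i])
    (P := Psi_eps Psi Phi Ups1 Ups2 alpha beta gamma1 gamma2 e) :
  a < b -> smooth_on a b U ->
  C0infty Psi -> C0infty Phi -> C0infty Ups1 -> C0infty Ups2 ->
  eigenpair a b (S_eps a b U Psi Phi Ups1 Ups2 alpha beta gamma1 gamma2 e) lam y ->
  L2norm a b y = 1 ->
  exists D : (nat -> R -> R) * (nat -> R -> R),
  [/\ solves a b (fun x => complex.Re lam - U x - P x) D.1 /\
        solves a b (fun x => complex.Re lam - U x - P x) D.2,
      [/\ D.1 0%N a = 0, D.1 1%N a = 0, D.1 0%N b = 0 & D.1 1%N b = 0] /\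
        [/\ D.2 0%N a = 0, D.2 1%N a = 0, D.2 0%N b = 0 & D.2 1%N b = 0],
      ae_on a b (fun x => complex.Re (y x) = D.1 0%N x /\ complex.Im (y x) = D.2 0%N x),
      complex.Im lam = 0 &
      (\int[mu]_(x in `[a, b]) (D.1 0%N x ^+ 2)%:E <= 1)%E /\
        (\int[mu]_(x in `[a, b]) (D.2 0%N x ^+ 2)%:E <= 1)%E].
Proof.
move=> ab sU C1 C2 C3 C4 [[my1 my2 _] _ Sy] norm1.
have [Dr [Di [[dr di] yD bcr bci H4]]] := eigenfunction_regular ab sU C1 C2 C3 C4 Sy.
have cr0 := dr.1 0%N isT; have ci0 := di.1 0%N isT.
have c2r := within_exprn2 cr0; have c2i := within_exprn2 ci0.
have c2 := within_add c2r c2i.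
have yD' : ae_on a b (fun x => complex.Re (y x) = Dr 0%N x /\ complex.Im (y x) = Di 0%N x).
  by apply: ae_onS yD => x _ ->.
have int1 : \int[mu]_(x in `[a, b]) (Dr 0%N x ^+ 2 + Di 0%N x ^+ 2) = 1.
  rewrite Rintegral_cc_oo; last exact: continuous_measurable_oo.
  move: norm1; rewrite L2normE => norm1.
  rewrite -(@Rintegral_ae_eq _ a b
    (fun x => complex.Re (y x) ^+ 2 + complex.Im (y x) ^+ 2)).
  - have -> : 1 = Num.sqrt (\int[mu]_(x in `]a, b[)
      (complex.Re (y x) ^+ 2 + complex.Im (y x) ^+ 2)) ^+ 2 by rewrite norm1 expr1n.
    rewrite sqr_sqrtr//; apply: Rintegral_ge0 => x _.
    by rewrite addr_ge0// sqr_ge0.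
  - by apply: measurable_funD; exact: measurable_funX.
  - exact: continuous_measurable_oo.
  - by apply: ae_onS yD' => x _ [-> ->].
have le1 f : {within `[a, b], continuous f} ->
    (forall x, f x <= Dr 0%N x ^+ 2 + Di 0%N x ^+ 2) ->
    (\int[mu]_(x in `[a, b]) (f x)%:E <= 1)%E.
  move=> cf fle; have fi := continuous_integrable cf.
  have fn : (\int[mu]_(x in `[a, b]) (f x)%:E)%E \is a fin_num.
    exact: integrable_fin_num fi.
  rewrite -(fineK fn) lee_fin -int1; apply: le_Rintegral => //.
  exact: continuous_integrable.
have im0 : complex.Im lam = 0 by exact: (eigenvalue_real ab dr di bcr bci H4 int1).
exists (Dr, Di); split => //.
- split; split => // x _ /=.
    by rewrite (H4 x).1 im0 mul0r subr0.
  by rewrite (H4 x).2 im0 mul0r addr0.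
- by split; apply: le1 => // x; rewrite ?lerDl ?lerDr sqr_ge0.
Qed.

Lemma limit_eigenpair_ultra (a b : R) (U Psi Phi Ups1 Ups2 : R -> R)
    (alpha beta gamma1 gamma2 : R) (I : set R) (lambda_ : R -> R[i])
    (y_ : R -> R -> R[i]) (lambda : R[i]) (v : R -> R[i]) (G : set_system R) :
  a < 0 -> 0 < b -> smooth_on a b U ->
  C0infty Psi -> C0infty Phi -> C0infty Ups1 -> C0infty Ups2 ->
  nondegenerate_resonance Psi alpha -> I `<=` `]0, 1[ ->
  (forall eps, I eps -> eigenpair a b
    (S_eps a b U Psi Phi Ups1 Ups2 alpha beta gamma1 gamma2 eps)
    (lambda_ eps) (y_ eps)) ->
  (forall eps, I eps -> L2norm a b (y_ eps) = 1) ->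
  cvgC (within I (nbhs (0 : R))) lambda_ lambda -> L2 a b v ->
  L2weak_cvg a b (within I (nbhs (0 : R))) y_ v ->
  UltraFilter G -> within I (nbhs (0 : R)) `<=` G ->
  eigenpair a b (S_lim a b U Psi Phi alpha beta) lambda v /\
  L2strong_cvg a b G y_ v.
Proof.
move=> a0 b0 sU C1 C2 C3 C4 nd Isub eig norm1 lamc vL2 weak UG sG.
have ab : a < b by lra.
have GI : G I by apply: sG; rewrite /within /=; exact: filterE.
have e0 : \forall e \near G, 0 < e.
  by apply: filterS GI => e /Isub; rewrite /= in_itv /= => /andP[].
have ec : e @[e --> G] --> (0 : R).
  by move=> V nV; apply: sG; apply: filterS nV => x Vx _.
have toG (u : R -> R) (c : R) : u e @[e --> within I (nbhs (0 : R))] --> c ->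
    u e @[e --> G] --> c.
  by move=> H V nV; apply: sG; exact: H.
have [/toG lamr /toG lami] := cvgC_Re_Im lamc.
have /choice [DD HDD] : forall e, exists D : (nat -> R -> R) * (nat -> R -> R), I e ->
  [/\ solves a b (fun x => complex.Re (lambda_ e) - U x -
         Psi_eps Psi Phi Ups1 Ups2 alpha beta gamma1 gamma2 e x) D.1 /\
        solves a b (fun x => complex.Re (lambda_ e) - U x -
         Psi_eps Psi Phi Ups1 Ups2 alpha beta gamma1 gamma2 e x) D.2,
      [/\ D.1 0%N a = 0, D.1 1%N a = 0, D.1 0%N b = 0 & D.1 1%N b = 0] /\
        [/\ D.2 0%N a = 0, D.2 1%N a = 0, D.2 0%N b = 0 & D.2 1%N b = 0],
      ae_on a b (fun x => complex.Re (y_ e x) = D.1 0%N x /\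
                          complex.Im (y_ e x) = D.2 0%N x),
      complex.Im (lambda_ e) = 0 &
      (\int[mu]_(x in `[a, b]) (D.1 0%N x ^+ 2)%:E <= 1)%E /\
        (\int[mu]_(x in `[a, b]) (D.2 0%N x ^+ 2)%:E <= 1)%E].
  (* Outside I nothing is required, and zero functions serve as a default. *)
  move=> e; have [Ie|nIe] := pselect (I e); last by exists (fun _ _ => 0, fun _ _ => 0).
  have [D HD] := eigenfunction_components ab sU C1 C2 C3 C4 (eig e Ie) (norm1 e Ie).
  by exists D.
have lam_im : complex.Im lambda = 0.
  have c0 : (fun=> 0) e @[e --> G] --> (0 : R) by exact: cvg_cst.
  apply: (cvg_eq_limits lami); apply: near_cvg c0; apply: filterS GI => e Ie.
  by have [] := HDD e Ie.
have [||| Dmr [Dpr [sDmr sDpr [amr1 amr2 bpr1 bpr2] intr ur]]] :=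
    @real_limit R G UG a b U Psi Phi Ups1 Ups2
    alpha beta gamma1 gamma2 (fun e => complex.Re (lambda_ e)) (complex.Re lambda)
    (fun e => (DD e).1) a0 b0 sU C1 C2 C3 C4 nd lamr e0 ec.
- by apply: filterS GI => e Ie; have [[]] := HDD e Ie.
- by apply: filterS GI => e Ie; have [_ []] := HDD e Ie.
- by apply: filterS GI => e Ie; have [_ _ _ _ []] := HDD e Ie.
have [||| Dmi [Dpi [sDmi sDpi [ami1 ami2 bpi1 bpi2] inti ui]]] :=
    @real_limit R G UG a b U Psi Phi Ups1 Ups2
    alpha beta gamma1 gamma2 (fun e => complex.Re (lambda_ e)) (complex.Re lambda)
    (fun e => (DD e).2) a0 b0 sU C1 C2 C3 C4 nd lamr e0 ec.
- by apply: filterS GI => e Ie; have [[]] := HDD e Ie.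
- by apply: filterS GI => e Ie; have [_ []] := HDD e Ie.
- by apply: filterS GI => e Ie; have [_ _ _ _ []] := HDD e Ie.
pose Vr x := if x <= 0 then Dmr 0%N x else Dpr 0%N x.
pose Vi x := if x <= 0 then Dmi 0%N x else Dpi 0%N x.
have cr e : I e -> {within `[a, b], continuous (DD e).1 0%N}.
  by move=> Ie; have [[[[H _] _] _] _ _ _ _] := HDD e Ie; exact: (H 0%N isT).
have ci e : I e -> {within `[a, b], continuous (DD e).2 0%N}.
  by move=> Ie; have [[_ [[H _] _]] _ _ _ _] := HDD e Ie; exact: (H 0%N isT).
have cVr : {within `[a, b], continuous Vr}.
  exact: (unif_cvg_within ur (filterS cr GI)).
have cVi : {within `[a, b], continuous Vi}.
  exact: (unif_cvg_within ui (filterS ci GI)).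
have [mv1 mv2 vfin] := vL2.
have my e : I e -> measurable_fun `]a, b[ (fun x => complex.Re (y_ e x)) /\
    measurable_fun `]a, b[ (fun x => complex.Im (y_ e x)).
  by move=> Ie; have [[]] := eig e Ie.
have vV : ae_on a b (fun x => complex.Re (v x) = Vr x /\ complex.Im (v x) = Vi x).
  apply: (@weak_limit_unique R G a b (fun e x => complex.Re (y_ e x))
    (fun e x => complex.Im (y_ e x)) (fun e => (DD e).1 0%N) (fun e => (DD e).2 0%N)
    _ _ _ _ _ ab mv1 mv2 vfin cVr cVi _ ur ui).
    apply: filterS GI => e Ie; have [m1 m2] := my e Ie; have [_ _ H _ _] := HDD e Ie.
    by split => //; [exact: cr|exact: ci].
  move=> h1 h2 mh1 mh2 hfin.
  have hL2 : L2 a b (fun x => h1 x +i* h2 x) by split.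
  have [/toG H _] := cvgC_Re_Im (weak _ hL2).
  by rewrite Re_L2inner in H; apply: near_cvg H; apply: nearW => e; rewrite Re_L2inner.
pose X e := \int[mu]_(x in `]a, b[) (complex.Re (y_ e x - v x) ^+ 2 +
  complex.Im (y_ e x - v x) ^+ 2).
have X_eq e (w1 w2 : R -> R) : I e ->
    measurable_fun `]a, b[ (fun x => w1 x ^+ 2 + w2 x ^+ 2) ->
    ae_on a b (fun x => complex.Re (y_ e x) - complex.Re (v x) = w1 x /\
      complex.Im (y_ e x) - complex.Im (v x) = w2 x) ->
    X e = \int[mu]_(x in `]a, b[) (w1 x ^+ 2 + w2 x ^+ 2).
  move=> Ie mw Hw; have [m1 m2] := my e Ie.
  have -> : X e = \int[mu]_(x in `]a, b[) ((complex.Re (y_ e x) - complex.Re (v x)) ^+ 2 +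
      (complex.Im (y_ e x) - complex.Im (v x)) ^+ 2).
    by apply: eq_Rintegral => x _; rewrite complex_ReD complex_ImD complex_ReN complex_ImN.
  apply: Rintegral_ae_eq => //.
    by apply: measurable_funD; apply: measurable_funX; exact: measurable_funB.
  by apply: ae_onS Hw => x _ [-> ->].
have X0 : X e @[e --> G] --> (0 : R).
  apply/cvgrPdist_le => d d0.
  have ba : 0 < b - a by lra.
  pose t := Num.min 1 (d / (2 * (b - a))).
  have t0 : 0 < t by rewrite lt_min ltr01 divr_gt0// mulr_gt0.
  have t1 : t <= 1 by rewrite ge_min lexx.
  have t2 : t * (2 * (b - a)) <= d by rewrite -ler_pdivlMr ?mulr_gt0// ge_min lexx orbT.
  apply: filterS3 GI (ur t t0) (ui t t0) => e Ie Hr Hi.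
  have [_ _ yD _ _] := HDD e Ie.
  have cw : {within `[a, b], continuous (fun x => ((DD e).1 0%N x - Vr x) ^+ 2 +
      ((DD e).2 0%N x - Vi x) ^+ 2)}.
    exact: within_add (within_exprn2 (within_sub (cr e Ie) cVr))
      (within_exprn2 (within_sub (ci e Ie) cVi)).
  have mw := continuous_measurable_oo cw.
  have -> : X e = \int[mu]_(x in `]a, b[) (((DD e).1 0%N x - Vr x) ^+ 2 +
      ((DD e).2 0%N x - Vi x) ^+ 2).
    apply: (X_eq e (fun x => (DD e).1 0%N x - Vr x) (fun x => (DD e).2 0%N x - Vi x)) => //.
    by apply: ae_onS2 yD vV => x _ [-> ->] [-> ->].
  rewrite -Rintegral_cc_oo// sub0r normrN.
  apply: le_trans (Rintegral_le_cst (c := 2 * t) ab cw _) _; last by nra.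
  (* This uses t <= 1, the reason for the minimum in the choice of t. *)
  have sq (z : R) : `|z| < t -> z ^+ 2 <= t.
    rewrite ltr_norml => /andP[? ?]; nra.
  move=> x xl; rewrite ger0_norm ?addr_ge0 ?sqr_ge0//.
  have -> : 2 * t = t + t by ring.
  by apply: lerD; apply: sq; [exact: Hr|exact: Hi].
split; last first.
  rewrite /L2strong_cvg -[X in _ --> X](@sqrtr0 R).
  have H := cvg_comp _ _ X0 (@sqrt_continuous R 0).
  apply: near_cvg H; apply: nearW => e; rewrite L2normE.
  by [].
split => //.
  (* If v vanished almost everywhere, the squared distance X would be the squared norm of y_e,
     identically 1 on I, whereas it tends to 0. *)
  move=> v0; have X1 : X e @[e --> G] --> (1 : R).
    have c1 : (fun=> 1) e @[e --> G] --> (1 : R) by exact: cvg_cst.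
    apply: near_cvg c1; apply: filterS GI => e Ie; have [m1 m2] := my e Ie.
    rewrite (X_eq e (fun x => complex.Re (y_ e x)) (fun x => complex.Im (y_ e x)) Ie).
    - have /(congr1 (fun z => z ^+ 2)) := norm1 e Ie.
      rewrite L2normE sqr_sqrtr ?expr1n//; apply: Rintegral_ge0 => x _.
      by rewrite addr_ge0// sqr_ge0.
    - by apply: measurable_funD; exact: measurable_funX.
    - by apply: ae_onS v0 => x _ -> /=; rewrite !subr0.
  have : 0 = 1 :> R by exact: cvg_eq_limits X0 X1.
  by move/eqP; rewrite eq_sym oner_eq0.
have vVm : ae_on a 0 (fun x => v x = Dmr 0%N x +i* Dmi 0%N x).
  have := ae_on_sub (lexx a) (ltW b0) vV; apply: ae_onS => x.
  rewrite in_itv /= => /andP[_ /ltW x0] []; rewrite /Vr /Vi x0 => E1 E2.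
  exact: complex_ext.
have vVp : ae_on 0 b (fun x => v x = Dpr 0%N x +i* Dpi 0%N x).
  have := ae_on_sub (ltW a0) (lexx b) vV; apply: ae_onS => x.
  rewrite in_itv /= => /andP[x0 _] []; rewrite /Vr /Vi leNgt x0 => E1 E2.
  exact: complex_ext.
exists (fun k x => Dmr k x +i* Dmi k x), (fun k x => Dpr k x +i* Dpi k x); split.
- split => //; apply: W24_of_derivatives => //.
  + exact: sDmr.1.
  + exact: sDmi.1.
  + exact: sDpr.1.
  + exact: sDpi.1.
- by split; rewrite ?amr1 ?amr2 ?bpr1 ?bpr2 ?ami1 ?ami2 ?bpi1 ?bpi2.
- exact: complex_interface.
- apply: ae_onS vVm => x xl ->; have xc := subset_itv_oo_cc xl.
  by apply: complex_ext; rewrite !complex_ReImE /= lam_im ?(sDmr.2 x xc) ?(sDmi.2 x xc); ring.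
- apply: ae_onS vVp => x xl ->; have xc := subset_itv_oo_cc xl.
  by apply: complex_ext; rewrite !complex_ReImE /= lam_im ?(sDpr.2 x xc) ?(sDpi.2 x xc); ring.
Qed.

End limit.

Theorem theorem5p1 (R : realType) (a b : R) (U Psi Phi Ups1 Ups2 : R -> R)
    (alpha beta gamma1 gamma2 : R)
    (a_lt0 : a < 0) (b_gt0 : 0 < b)
    (U_smooth : smooth_on a b U)
    (Psi_C0 : C0infty Psi) (Phi_C0 : C0infty Phi)
    (Ups1_C0 : C0infty Ups1) (Ups2_C0 : C0infty Ups2)
    (supp_Psi : closure [set x : R | Psi x != 0] = `[-1, 1]%classic)
    (nondeg : nondegenerate_resonance Psi alpha)
    (I : set R) (I_sub : I `<=` `]0, 1[) (I_inf : infinite_set I)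
    (I_acc : limit_point I 0)
    (lambda_ : R -> R[i]) (y_ : R -> R -> R[i])
    (lambda : R[i]) (v : R -> R[i])
    (eig : forall eps, I eps ->
       eigenpair a b
         (S_eps a b U Psi Phi Ups1 Ups2 alpha beta gamma1 gamma2 eps)
         (lambda_ eps) (y_ eps))
    (y_normalized : forall eps, I eps -> L2norm a b (y_ eps) = 1)
    (lambda_cvg : cvgC (within I (nbhs (0 : R))) lambda_ lambda)
    (v_L2 : L2 a b v)
    (y_weak_cvg : L2weak_cvg a b (within I (nbhs (0 : R))) y_ v) :
  eigenpair a b (S_lim a b U Psi Phi alpha beta) lambda v /\
  L2strong_cvg a b (within I (nbhs (0 : R))) y_ v.

Proof.
(* Properness is where the accumulation of I at 0 enters. *)
have F_proper : ProperFilter (within I (nbhs (0 : R))).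
  split; last exact: within_filter.
  rewrite /within /= => H.
  by have [y [_ Iy /(_ Iy)]] := I_acc _ H.
have ultra := fun G => @limit_eigenpair_ultra R a b U Psi Phi Ups1 Ups2 alpha beta
  gamma1 gamma2 I lambda_ y_ lambda v G a_lt0 b_gt0 U_smooth Psi_C0 Phi_C0 Ups1_C0
  Ups2_C0 nondeg I_sub eig y_normalized lambda_cvg v_L2 y_weak_cvg.
split.
  (* The eigenpair statement does not mention the ultrafilter, so one of them suffices; strong
     convergence is tested on all of them. *)
  have [G [UG FG]] := ultraFilterLemma F_proper.
  exact: (ultra G UG FG).1.
apply: cvg_ultra => G UG FG.
exact: (ultra G UG FG).2.
Qed.
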